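(* Let $p$ be a prime. Let $d \ge 1$ and $n = (p-1)d - 1$ be integers. Fix some free $\mathbb{Z}/p$-action on $S^n$. Let $A_i \subset S^n$ be closed sets for $i \in [d]$ such that $S^n = \bigcup_{i \in [d]} \bigcup_{g \in \mathbb{Z}/p} g \cdot A_i$. Suppose that $\bigcap_{g \in \mathbb{Z}/p} g \cdot A_i = \emptyset$ for every $i \in [d]$. Then for all $s_1, \dots, s_d \in \mathbb{Z}/p$ we have $\bigcap_{i \in [d]} \bigcap_{g \in \mathbb{Z}/p \setminus \{s_i\}} g \cdot A_i \ne \emptyset$.
   Context: $[d] = \{1,\dots,d\}$. A (continuous) $\mathbb{Z}/p$-action on $S^n$ is free if $g \cdot x \ne x$ for all $g \in \mathbb{Z}/p \setminus \{0\}$ and all $x \in S^n$. For $A \subseteq S^n$ and $g \in \mathbb{Z}/p$, $g \cdot A = \{g \cdot x : x \in A\}$. *)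

(* Defs.v *)
From HB Require Import structures.
From mathcomp Require Import all_boot all_order all_algebra all_fingroup.
From mathcomp Require Import all_classical all_reals all_analysis.

Set Implicit Arguments.
Unset Strict Implicit.
Unset Printing Implicit Defensive.

Import Order.TTheory GRing.Theory Num.Theory.
Import numFieldNormedType.Exports.

Local Open Scope classical_set_scope.
Local Open Scope ring_scope.

(* The norm that the library puts on row vectors is the sup norm, so the
   Euclidean norm is spelled out. Used as a type, [sphere R n] is a [set_type],
   which carries the subspace topology. *)
Definition sphere (R : realType) (n : nat) : set 'rV[R]_n.+1 :=
  [set x | \sum_(i < n.+1) x ord0 i ^+ 2 = 1].
Arguments sphere R n : clear implicits.

(* As a [finGroupType], ['Z_p] is the additive group: [(g * h)%g] is [g + h] and
   [1%g] is [0]. Actions in the library are right actions, [to x g]; since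
   ['Z_p] is abelian, this is the same thing as a left action g . x. *)
Definition continuous_action (p : nat) (X : topologicalType)
    (to : {action 'Z_p &-> X}) : Prop :=
  forall g : 'Z_p, continuous (fun x : X => to x g).

Definition free_action (p : nat) (X : Type) (to : {action 'Z_p &-> X}) : Prop :=
  forall g : 'Z_p, g != 0 -> forall x : X, to x g <> x.

Definition translate (p : nat) (X : Type) (to : {action 'Z_p &-> X})
    (g : 'Z_p) (A : set X) : set X :=
  (fun x : X => to x g) @` A.

(* Main.v *)
Require Import Defs.
From HB Require Import structures.
From mathcomp Require Import all_boot all_order all_algebra all_fingroup.
From mathcomp Require Import all_classical all_reals all_analysis.
From mathcomp Require Import ring lra.

Set Implicit Arguments.
Unset Strict Implicit.
Unset Printing Implicit Defensive.

Import Order.TTheory GRing.Theory Num.Theory.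
Import numFieldNormedType.Exports.

Local Open Scope classical_set_scope.
Local Open Scope ring_scope.

(* Homology is replaced by Vietoris chains: finite formal sums of tuples of
   points at small mutual distance. Small cycles of dimension < n on S^n bound
   small chains: cut the cycle along the equator, fill the common boundary of
   the two halves inside S^(n-1), and contract each hemisphere. Writing g for a
   generator of Z/p, and starting from a point x_0, this yields chains x_k with
   boundary (g - 1) x_(k-1) for k odd and (1 + g + ... + g^(p-1)) x_(k-1) for k
   even. Labelling a point of g.A_i equivariantly by (i, g) maps small tuples to
   simplices of the d-fold join of the boundary of a (p-1)-simplex, on which
   Z/p acts freely since p is prime. A dual tower of alternating cochains there
   shows that the norm of the image of x_n is a cycle pairing to 1 with a top
   cochain. But it is a top-dimensional cycle in a pseudomanifold, and if the
   intersection for s_1, ..., s_d were empty it would miss one facet, hence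
   vanish. *)

(** The labelling is far from continuous, but tuples can be pushed forward along any map; the sets
    [A i] enter only through Lebesgue numbers. A small ball misses some [g.A_i] for each [i], so
    labels of a small tuple never fill a column. If the intersection is empty, a small ball also
    misses some [g.A_i] with [g] different from [s i], so the facet omitting the vertices [(i, s i)]
    is never hit. A facet of the join omits one vertex in each of [d] columns, so it has (p - 1) d =
    n + 1 vertices: the complex has the dimension of the sphere, and that is why the image of an
    n-cycle has top dimension. Coefficients lie in ['Z_p], where p = 0, and then the norm is a
    multiple of g - 1. This carries one pairing, against the norm of a cochain, through both
    parities of the tower. Each filling loses fineness, so fillings are stated as: for every [e]
    there is a [d]; the scales of the tower are fixed from the top down. *)

(* Chains are only compared through their pairing [ev] with cochains. Tuples
   include the empty one, of degree -1, so homology is reduced. *)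
Definition chain (F X : Type) := seq (F * seq X).
Definition cochain (F X : Type) := seq X -> F.

(** * Formal sums of tuples and their pairing with cochains *)

Section Chains.
Variable F : comNzRingType.
Implicit Types X Y : eqType.

Definition ev X (f : cochain F X) (c : chain F X) : F :=
  \sum_(u <- c) u.1 * f u.2.

Definition sat X (P : pred (seq X)) (c : chain F X) : bool :=
  all (fun u => P u.2) c.

Lemma ev_nil X (f : cochain F X) : ev f [::] = 0.
Proof. by rewrite /ev big_nil. Qed.

Lemma ev_cons X (f : cochain F X) u c : ev f (u :: c) = u.1 * f u.2 + ev f c.
Proof. by rewrite /ev big_cons. Qed.

Lemma ev1 X (f : cochain F X) a s : ev f [:: (a, s)] = a * f s.
Proof. by rewrite ev_cons ev_nil addr0. Qed.

Lemma ev_cat X (f : cochain F X) c1 c2 : ev f (c1 ++ c2) = ev f c1 + ev f c2.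
Proof. by rewrite /ev big_cat. Qed.

Lemma eq_ev X (P : pred (seq X)) (f g : cochain F X) c : sat P c ->
  (forall s, P s -> f s = g s) -> ev f c = ev g c.
Proof.
move=> cP fg; elim: c cP => [|u c IH] /=; first by rewrite !ev_nil.
by case/andP=> /fg fgu /IH cE; rewrite !ev_cons fgu cE.
Qed.

Lemma eq_ev_fun X (f g : cochain F X) c : f =1 g -> ev f c = ev g c.
Proof. by move=> fg; apply: eq_bigr => u _; rewrite fg. Qed.

Lemma eq_ev0 X (f : cochain F X) c : (forall s, f s = 0) -> ev f c = 0.
Proof. by move=> f0; rewrite /ev big1 // => u _; rewrite f0 mulr0. Qed.

Lemma ev_add X (f g : cochain F X) c :
  ev (fun s => f s + g s) c = ev f c + ev g c.
Proof. by rewrite /ev -big_split; apply: eq_bigr => u _; rewrite mulrDr. Qed.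

Lemma ev_scale X (f : cochain F X) a c : ev (fun s => a * f s) c = a * ev f c.
Proof. by rewrite /ev mulr_sumr; apply: eq_bigr => u _; rewrite mulrCA. Qed.

Lemma ev_sub X (f g : cochain F X) c :
  ev (fun s => f s - g s) c = ev f c - ev g c.
Proof. by rewrite /ev -sumrB; apply: eq_bigr => u _; rewrite mulrBr. Qed.

Lemma ev_sum X (I : Type) (r : seq I) (f : I -> cochain F X) c :
  ev (fun s => \sum_(i <- r) f i s) c = \sum_(i <- r) ev (f i) c.
Proof. by rewrite /ev exchange_big; apply: eq_bigr => u _; rewrite mulr_sumr. Qed.

Definition oppc X (c : chain F X) : chain F X := [seq (- u.1, u.2) | u <- c].

Lemma ev_oppc X (f : cochain F X) c : ev f (oppc c) = - ev f c.
Proof.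
by rewrite /ev big_map -sumrN; apply: eq_bigr => u _; rewrite mulNr.
Qed.

Lemma sat_cat X (P : pred (seq X)) c1 c2 :
  sat P (c1 ++ c2) = sat P c1 && sat P c2.
Proof. exact: all_cat. Qed.

Lemma sat_oppc X (P : pred (seq X)) c : sat P (oppc c) = sat P c.
Proof. by rewrite /sat all_map. Qed.

Lemma sat_sub X (P Q : pred (seq X)) c :
  (forall s, P s -> Q s) -> sat P c -> sat Q c.
Proof. by move=> PQ; apply: sub_all => u; apply: PQ. Qed.

Lemma sat_predI X (P Q : pred (seq X)) c :
  sat P c -> sat Q c -> sat (predI P Q) c.
Proof.
by move=> cP cQ; rewrite /sat (all_predI (P \o snd) (Q \o snd)); apply/andP.
Qed.

Definition restr X (P : pred (seq X)) (c : chain F X) : chain F X :=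
  [seq u <- c | P u.2].

Lemma ev_restr X (P : pred (seq X)) (f : cochain F X) c :
  ev f (restr P c) = ev (fun s => if P s then f s else 0) c.
Proof.
rewrite /ev big_filter big_mkcond /=; apply: eq_bigr => u _.
by case: ifP; rewrite ?mulr0.
Qed.

Lemma ev_split X (P : pred (seq X)) (f : cochain F X) c :
  ev f c = ev f (restr P c) + ev f (restr (predC P) c).
Proof.
rewrite !ev_restr -ev_add; apply: eq_ev_fun => s /=.
by case: (P s); rewrite ?addr0 ?add0r.
Qed.

Lemma sat_restr X (P Q : pred (seq X)) c :
  sat P c -> sat (predI P Q) (restr Q c).
Proof.
move=> cP; rewrite /sat all_filter; apply: sub_all cP => u /= ->.
by apply/implyP.
Qed.

Definition bindc X Y (k : seq X -> chain F Y) (c : chain F X) : chain F Y :=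
  flatten [seq [seq (u.1 * v.1, v.2) | v <- k u.2] | u <- c].

Lemma ev_bindc X Y (k : seq X -> chain F Y) f c :
  ev f (bindc k c) = ev (fun s => ev f (k s)) c.
Proof.
elim: c => [|u c IH]; first by rewrite !ev_nil.
rewrite /bindc /= ev_cat IH ev_cons; congr (_ + _).
by rewrite /ev big_map mulr_sumr; apply: eq_bigr => v _; rewrite mulrA.
Qed.

Lemma sat_bindc X Y (k : seq X -> chain F Y) (P : pred (seq X))
    (Q : pred (seq Y)) c :
  sat P c -> (forall s, P s -> sat Q (k s)) -> sat Q (bindc k c).
Proof.
move=> cP PQ; elim: c cP => //= u c IH /andP[uP cP].
rewrite /bindc /= sat_cat [X in _ && X]IH // andbT /sat all_map.
exact: PQ.
Qed.

(** * Boundaries *)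

(** The alternating sum over the faces of a tuple, unfolded at the head. The only face of a
    one-point tuple is the empty tuple, as in augmented chains. *)
Fixpoint cob X (f : cochain F X) (s : seq X) : F :=
  if s is x :: t then f t - cob (fun t => f (x :: t)) t else 0.

Fixpoint bd_simplex X (s : seq X) : chain F X :=
  if s is x :: t then
    (1, t) :: [seq (- u.1, x :: u.2) | u <- bd_simplex t]
  else [::].

Definition bd X : chain F X -> chain F X := bindc (@bd_simplex X).

Lemma ev_bd_simplex X (f : cochain F X) s : ev f (bd_simplex s) = cob f s.
Proof.
elim: s f => [|x s IH] f /=; first exact: ev_nil.
rewrite ev_cons mul1r -IH /ev big_map -sumrN; congr (_ + _).
by apply: eq_bigr => u _; rewrite mulNr.
Qed.

Lemma eq_cob X (f g : cochain F X) s :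
  (forall t, {subset t <= s} -> (size t).+1 = size s -> f t = g t) ->
  cob f s = cob g s.
Proof.
elim: s f g => //= x s IH f g fg; rewrite fg //; last first.
  by move=> y ys; rewrite inE ys orbT.
congr (_ - _); apply: IH => t ts st; apply: fg => /=; last by rewrite st.
by move=> y; rewrite !inE => /orP[->//|/ts->]; rewrite orbT.
Qed.

Lemma eq_cob_fun X (f g : cochain F X) s : f =1 g -> cob f s = cob g s.
Proof. by move=> fg; apply: eq_cob. Qed.

Lemma ev_bd X (f : cochain F X) c : ev f (bd c) = ev (cob f) c.
Proof.
by rewrite /bd ev_bindc; apply: eq_ev_fun => s; rewrite ev_bd_simplex.
Qed.

Lemma cob0 X (f : cochain F X) s : (forall t, f t = 0) -> cob f s = 0.
Proof. by elim: s f => //= x s IH f f0; rewrite f0 IH ?subr0. Qed.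

Lemma cobB X (f g : cochain F X) s :
  cob (fun t => f t - g t) s = cob f s - cob g s.
Proof.
elim: s f g => [|x s IH] f g /=; first by rewrite subr0.
by rewrite IH; ring.
Qed.

Lemma cob_sum X (I : Type) (r : seq I) (a : I -> F) (f : I -> cochain F X) s :
  cob (fun t => \sum_(i <- r) a i * f i t) s = \sum_(i <- r) a i * cob (f i) s.
Proof.
elim: s f => [|x s IH] f /=; first by rewrite big1 // => i _; rewrite mulr0.
rewrite (IH (fun i t => f i (x :: t))) -sumrB.
by apply: eq_bigr => i _; rewrite mulrBr.
Qed.

Lemma cob_cob X (f : cochain F X) s : cob (cob f) s = 0.
Proof.
elim: s f => //= x s IH f.
have -> : cob (fun t => f t - cob (fun t => f (x :: t)) t) s =
    cob f s - cob (cob (fun t => f (x :: t))) s by exact: cobB.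
by rewrite IH subr0 subrr.
Qed.

Lemma cob_map X Y (h : X -> Y) (f : cochain F Y) s :
  cob (fun t => f (map h t)) s = cob f (map h s).
Proof. by elim: s f => //= x s IH f; rewrite -IH. Qed.

Lemma sat_bd X (P Q : pred (seq X)) c : sat P c ->
  (forall s t, P s -> {subset t <= s} -> (size t).+1 = size s -> Q t) ->
  sat Q (bd c).
Proof.
move=> cP PQ; apply: sat_bindc cP _ => s /PQ{PQ}.
elim: s Q => // x s IH Q PQ; rewrite /sat /=; apply/andP; split.
  by apply: PQ => // y ys; rewrite inE ys orbT.
rewrite all_map; apply: (IH (fun t => Q (x :: t))) => t ts st.
apply: PQ => /=; last by rewrite st.
by move=> y; rewrite !inE => /orP[->//|/ts->]; rewrite orbT.
Qed.

Definition cycle_chain X (z : chain F X) := forall f, ev (cob f) z = 0.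

Definition bounds X (z w : chain F X) := forall f, ev f z = ev (cob f) w.

(** * Push-forward, prisms and cones *)

Definition push X Y (h : X -> Y) : chain F X -> chain F Y :=
  bindc (fun s => [:: (1, map h s)]).

Lemma ev_push X Y (h : X -> Y) f c :
  ev f (push h c) = ev (fun s => f (map h s)) c.
Proof.
by rewrite /push ev_bindc; apply: eq_ev_fun => s; rewrite ev1 mul1r.
Qed.

Lemma sat_push X Y (h : X -> Y) (P : pred (seq X)) (Q : pred (seq Y)) c :
  sat P c -> (forall s, P s -> Q (map h s)) -> sat Q (push h c).
Proof. by move=> cP PQ; apply: sat_bindc cP _ => s /PQ /= ->. Qed.

Lemma push_bounds X Y (h : X -> Y) z w :
  bounds z w -> bounds (push h z) (push h w).
Proof.
by move=> zw f; rewrite !ev_push zw; apply: eq_ev_fun => s; rewrite cob_map.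
Qed.

Lemma push_cycle X Y (h : X -> Y) z : cycle_chain z -> cycle_chain (push h z).
Proof.
move=> zc f; rewrite ev_push -(zc (fun s => f (map h s))).
by apply: eq_ev_fun => s; rewrite cob_map.
Qed.

(** The classical prism operator: the signed sum of the tuples
    [f x_0, ..., f x_i, g x_i, ..., g x_k]. *)
Fixpoint prism X Y (f g : X -> Y) (s : seq X) : chain F Y :=
  if s is x :: t then
    (1, f x :: map g s) :: [seq (- u.1, f x :: u.2) | u <- prism f g t]
  else [::].

Lemma ev_prism_cons X Y (f g : X -> Y) phi x s :
  ev phi (prism f g (x :: s)) =
  phi (f x :: map g (x :: s)) - ev (fun t => phi (f x :: t)) (prism f g s).
Proof.
rewrite /= ev_cons mul1r; congr (_ + _); rewrite /ev big_map -sumrN.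
by apply: eq_bigr => u _; rewrite mulNr.
Qed.

Lemma prism_homotopy X Y (f g : X -> Y) phi s :
  ev (cob phi) (prism f g s) + cob (fun t => ev phi (prism f g t)) s =
  phi (map g s) - phi (map f s).
Proof.
elim: s phi => [|x s IH] phi; first by rewrite /= ev_nil addr0 subrr.
set phix := fun t => phi (f x :: t).
have E1 : ev (cob phi) (prism f g (x :: s)) =
    phi (map g (x :: s)) - cob phix (map g (x :: s)) -
    (ev phi (prism f g s) - ev (cob phix) (prism f g s)).
  rewrite ev_prism_cons; congr (_ - _).
  by rewrite -ev_sub.
have E2 : cob (fun t => ev phi (prism f g t)) (x :: s) =
    ev phi (prism f g s) - (cob (fun t => phi (f x :: g x :: t)) (map g s) -
    cob (fun t => ev phix (prism f g t)) s).
  rewrite [LHS]/= -[cob _ (map g s)]cob_map -cobB; congr (_ - _).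
  by apply: eq_cob_fun => t; rewrite -ev_prism_cons.
rewrite E1 E2; have /eqP := IH phix.
rewrite eq_sym -subr_eq => /eqP <-.
rewrite /phix /=; ring.
Qed.

(** The second term of [prism_homotopy] is a coboundary, so it pairs to zero with a cycle. *)
Lemma homotopy_bounds X Y (f g : X -> Y) z phi : cycle_chain z ->
  ev phi (push g z) - ev phi (push f z) =
  ev (cob phi) (bindc (prism f g) z).
Proof.
move=> zc; rewrite ev_bindc !ev_push -[RHS]addr0.
rewrite -(zc (fun t => ev phi (prism f g t))) -ev_add -ev_sub.
by apply: eq_ev_fun => s; rewrite prism_homotopy.
Qed.

Lemma sat_prism X Y (f g : X -> Y) (Q : pred (seq Y)) s :
  (forall t, size t = (size s).+1 ->
     (forall y, y \in t -> exists2 x, x \in s & y = f x \/ y = g x) -> Q t) ->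
  sat Q (prism f g s).
Proof.
elim: s Q => // x s IH Q Qt; rewrite /sat /=; apply/andP; split.
  apply: Qt => /=; first by rewrite size_map.
  move=> y; rewrite !inE => /or3P[/eqP->|/eqP->|/mapP[z zs ->]].
  - by exists x; [rewrite inE eqxx|left].
  - by exists x; [rewrite inE eqxx|right].
  - by exists z; [rewrite inE zs orbT|right].
rewrite all_map; apply: (IH (fun t => Q (f x :: t))) => t ts st.
apply: Qt => /=; first by rewrite ts.
move=> y; rewrite inE => /orP[/eqP->|/st[z zs yz]].
  by exists x; [rewrite inE eqxx|left].
by exists z; [rewrite inE zs orbT|].
Qed.

Definition cone X (x : X) : chain F X -> chain F X :=
  bindc (fun s => [:: (1, x :: s)]).

(** [cob f (x :: t)] is [f t] minus a coboundary evaluated at [t], and the latter disappears on a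
    cycle. *)
Lemma cone_bounds X (x : X) z : cycle_chain z -> bounds z (cone x z).
Proof.
move=> zc f; rewrite ev_bindc -[LHS]subr0 -(zc (fun t => f (x :: t))).
rewrite -ev_sub.
by apply: eq_ev_fun => s; rewrite ev1 mul1r.
Qed.

Lemma sat_cone X (x : X) (P Q : pred (seq X)) z : sat P z ->
  (forall s, P s -> Q (x :: s)) -> sat Q (cone x z).
Proof. by move=> zP PQ; apply: sat_bindc zP _ => s /PQ /= ->. Qed.
End Chains.
Arguments prism {F X Y} f g s.
Arguments bd_simplex {F X} s.

(** * Chains of tuples with a closeness relation *)

Section Fine.
Variable F : comNzRingType.

(** [m] counts points, so these tuples are simplices of dimension [m - 1]. *)
Definition fine (X : eqType) (S : pred X) (e : rel X) (m : nat) : pred (seq X) :=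
  fun s => [&& size s == m, all S s & allrel e s s].

Lemma fineP (X : eqType) (S : pred X) (e : rel X) m s :
  reflect [/\ size s = m, {in s, forall x, S x} & {in s &, forall x y, e x y}]
    (fine S e m s).
Proof.
apply: (iffP and3P) => [[/eqP sm /allP Ss /allrelP es]|[sm Ss es]].
  by split=> // x y; apply: es.
by split; [apply/eqP|apply/allP|apply/allrelP].
Qed.

Lemma fine_sub (X : eqType) (S S' : pred X) (e e' : rel X) m s :
  subpred S S' -> subrel e e' -> fine S e m s -> fine S' e' m s.
Proof.
move=> SS ee /fineP[sm Ss es]; apply/fineP; split=> // [x /Ss/SS|x y xs ys] //.
exact/ee/es.
Qed.

Lemma fine_map (X Y : eqType) (S : pred X) (e : rel X) (S' : pred Y)
    (e' : rel Y) (h : X -> Y) m s :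
  (forall x, S x -> S' (h x)) ->
  (forall x y, S x -> S y -> e x y -> e' (h x) (h y)) ->
  fine S e m s -> fine S' e' m (map h s).
Proof.
move=> SS ee /fineP[sm Ss es]; apply/fineP; split; first by rewrite size_map.
  by move=> _ /mapP[x /Ss/SS Sx ->].
move=> _ _ /mapP[x xs ->] /mapP[y ys ->].
by apply: ee; [exact: Ss|exact: Ss|exact: es].
Qed.

Lemma fine_face (X : eqType) (S : pred X) (e : rel X) m s t :
  fine S e m.+1 s -> {subset t <= s} -> (size t).+1 = size s -> fine S e m t.
Proof.
move=> /fineP[sm Ss es] ts st; apply/fineP; split.
- by move: st; rewrite sm => -[].
- by move=> x /ts/Ss.
- by move=> x y /ts xs /ts ys; apply: es.
Qed.

Lemma homotopy_fine (X Y : eqType) (S : pred X) (e : rel X) (S' : pred Y)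
    (e' : rel Y) (f g : X -> Y) m z :
  (forall x, S x -> S' (f x) /\ S' (g x)) ->
  (forall x y, S x -> S y -> e x y -> [/\ e' (f x) (f y), e' (g x) (g y),
    e' (f x) (g y) & e' (g x) (f y)]) ->
  cycle_chain z -> sat (fine S e m) z ->
  exists w : chain F Y, sat (fine S' e' m.+1) w /\
    forall phi, ev phi (push g z) - ev phi (push f z) = ev (cob phi) w.
Proof.
move=> SS ee zc zS; exists (bindc (prism f g) z); split; last first.
  by move=> phi; apply: homotopy_bounds.
apply: sat_bindc zS _ => s /fineP[sm Ss es].
apply: sat_prism => t st tfg; apply/fineP; split; first by rewrite st sm.
  by move=> y /tfg[x /Ss/SS[? ?] [->|->]].
move=> y y' /tfg[x xs yE] /tfg[x' xs' yE'].
have [? ? ? ?] := ee _ _ (Ss _ xs) (Ss _ xs') (es _ _ xs xs').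
by case: yE => ->; case: yE' => ->.
Qed.

(** A discrete contraction: only consecutive stages have to be close to each other. The prisms
    between them lead to a chain on copies of [x0], which is filled by a cone. *)
Lemma contraction_bounds (X : eqType) (U S : pred X) (e e' : rel X)
    (h : nat -> X -> X) (J : nat) (x0 : X) m (z : chain F X) :
  (forall x, U x -> h 0 x = x) -> (forall x, U x -> h J x = x0) ->
  S x0 -> e' x0 x0 -> (forall j x, U x -> S (h j x)) ->
  (forall j x y, U x -> U y -> e x y -> [/\ e' (h j x) (h j y),
     e' (h j x) (h j.+1 y) & e' (h j.+1 x) (h j y)]) ->
  cycle_chain z -> sat (fine U e m) z ->
  exists w : chain F X, sat (fine S e' m.+1) w /\ bounds z w.
Proof.
move=> h0 hJ Sx0 ex0 Sh eh zc zU.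
have hom k : exists w : chain F X, sat (fine S e' m.+1) w /\
    forall phi, ev phi (push (h k) z) - ev phi (push (h 0) z) = ev (cob phi) w.
  elim: k => [|k [w [wS wb]]].
    by exists [::]; split=> // phi; rewrite subrr ev_nil.
  have [||w' [w'S w'b]] := @homotopy_fine X X U e S e' (h k) (h k.+1) m z _ _ zc zU.
  - by move=> x Ux; split; apply: Sh.
  - by move=> x y Ux Uy xy; have [? ? ?] := eh k _ _ Ux Uy xy;
      have [? _ _] := eh k.+1 _ _ Ux Uy xy.
  exists (w' ++ w); split; first by rewrite sat_cat w'S.
  by move=> phi; rewrite ev_cat -w'b -wb addrA subrK.
have [w [wS wb]] := hom J.
exists (cone x0 (push (h J) z) ++ oppc w); split; last first.
  move=> phi; rewrite ev_cat ev_oppc -wb -cone_bounds; last exact: push_cycle.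
  rewrite opprB addrCA subrr addr0 ev_push; apply: eq_ev zU _ => s /fineP[_ Us _].
  by congr phi; rewrite -[LHS]map_id; apply/eq_in_map => x /Us/h0.
rewrite sat_cat sat_oppc wS andbT.
have: sat (fine (pred1 x0) (fun x y => (x == x0) && (y == x0)) m) (push (h J) z).
  apply: sat_push zU _ => s; apply: fine_map => [x /hJ/eqP //|x y Ux Uy _].
  by rewrite !hJ // !eqxx.
move=> zJ; apply: sat_cone zJ _ => s /fineP[sm sx _]; apply/fineP.
have tx : {in x0 :: s, forall x, x = x0}.
  by move=> x; rewrite inE => /orP[/eqP|/sx/eqP].
split=> [|x /tx->|x y /tx-> /tx->] //; by rewrite /= sm.
Qed.
End Fine.

(** * Small cycles on the boundary of a cube *)

Section Cube.
Variables (R : realType) (F : comNzRingType).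
Implicit Types (x y : nat -> R) (e : R).

Definition close e : rel (nat -> R) :=
  fun x y => `[< forall i, `|x i - y i| <= e >].

(* The boundary of [-1, 1]^N, with all further coordinates equal to 0, so that
   the equator of the boundary of [-1, 1]^(N+1) is literally that of [-1, 1]^N. *)
Definition cube N : pred (nat -> R) :=
  fun x => `[< [/\ forall i, `|x i| <= 1, exists2 i, (i < N)%N & `|x i| = 1 &
             forall i, (N <= i)%N -> x i = 0] >].

Lemma cubeS N x : cube N x -> cube N.+1 x.
Proof.
move=> /asboolP[x1 [i iN xi] x0]; apply/asboolP; split=> //.
  by exists i => //; apply: ltnW.
by move=> j Nj; apply/x0/ltnW.
Qed.

Lemma cube_equator N x : cube N.+1 x -> x N = 0 -> cube N x.
Proof.
move=> /asboolP[x1 [i iN xi] x0] xN; apply/asboolP; split=> //.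
  exists i => //; move: iN; rewrite ltnS leq_eqVlt => /orP[/eqP iN|//].
  by move: xi; rewrite iN xN normr0 => /esym/eqP; rewrite oner_eq0.
by move=> j; rewrite leq_eqVlt => /orP[/eqP <-|/x0].
Qed.

Lemma close_sub e e' : e <= e' -> subrel (close e) (close e').
Proof.
by move=> ee x y /asboolP xy; apply/asboolP => i; apply: le_trans (xy i) ee.
Qed.

(* For s from 0 to 1, flatten the half cube {0 <= sg * x N} onto its face
   {sg * x N = 1}; for s from 1 to 2, shrink this face to its center. *)
Definition shrink (sg : R) N (s : R) x : nat -> R := fun i =>
  if i == N then sg * Num.max (sg * x N) (Num.min 1 s)
  else x i * Num.max 0 (Num.min 1 (2 - s)).

Lemma max_lipschitz (a b a' b' e d : R) : `|a - a'| <= e -> `|b - b'| <= d ->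
  0 <= e -> 0 <= d ->
  `|Num.max a b - Num.max a' b'| <= e + d.
Proof.
rewrite !ler_norml => /andP[? ?] /andP[? ?] ? ?; apply/andP.
by rewrite /Num.max; case: ltP => ?; case: ltP => ?; split; lra.
Qed.

Lemma min_lipschitz (a b a' b' e d : R) : `|a - a'| <= e -> `|b - b'| <= d ->
  0 <= e -> 0 <= d ->
  `|Num.min a b - Num.min a' b'| <= e + d.
Proof.
rewrite !ler_norml => /andP[? ?] /andP[? ?] ? ?; apply/andP.
by rewrite /Num.min; case: ltP => ?; case: ltP => ?; split; lra.
Qed.

(** From time 1 on, coordinate [N] has absolute value 1. Before that no other coordinate has been
    shrunk, so the one that had absolute value 1 still has it. *)
Lemma shrink_cube (sg : R) N s x : `|sg| = 1 -> 0 <= s ->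
  cube N.+1 x -> 0 <= sg * x N -> cube N.+1 (shrink sg N s x).
Proof.
move=> sg1 s0 /asboolP[x1 [i iN xi] x0] xN0.
have xN1 : sg * x N <= 1.
  by apply: le_trans (ler_norm _) _; rewrite normrM sg1 mul1r.
have m0 : 0 <= Num.max 0 (Num.min 1 (2 - s)) <= 1.
  by rewrite le_max lexx /= ge_max ler01 ge_min lexx.
have M0 : 0 <= Num.max (sg * x N) (Num.min 1 s) <= 1.
  by rewrite le_max xN0 /= ge_max xN1 ge_min lexx.
apply/asboolP; split.
- move=> j; rewrite /shrink; case: eqP => _; rewrite normrM.
    by rewrite sg1 mul1r ger0_norm; case/andP: M0.
  case/andP: m0 => m0 m1; rewrite [X in _ * X]ger0_norm //.
  by rewrite mulr_ile1.
- have [s1|s1] := leP 1 s.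
    exists N => //; rewrite /shrink eqxx normrM sg1 mul1r.
    by rewrite (min_idPl s1) (max_idPr xN1) normr1.
  have [iE|iNe] := eqVneq i N.
    exists N => //; rewrite /shrink eqxx normrM sg1 mul1r.
    have -> : sg * x N = 1.
      by rewrite -(ger0_norm xN0) normrM sg1 mul1r -iE.
    by rewrite (max_idPl _) ?normr1 // ge_min lexx.
  exists i => //; rewrite /shrink (negPf iNe) (min_idPl _); last by lra.
  by rewrite (max_idPr _) ?mulr1.
- move=> j Nj; rewrite /shrink gtn_eqF // x0 ?mul0r //.
Qed.

Lemma shrink_close (sg : R) N s s' x y e d : `|sg| = 1 -> cube N.+1 y ->
  0 <= e -> close e x y -> `|s - s'| <= d ->
  close (e + d) (shrink sg N s x) (shrink sg N s' y).
Proof.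
move=> sg1 /asboolP[y1 _ _] e0 /asboolP xy ss.
have d0 : 0 <= d by apply: le_trans ss.
apply/asboolP => i; rewrite /shrink; case: eqP => _.
  rewrite -mulrBr normrM sg1 mul1r; apply: max_lipschitz => //.
    by rewrite -mulrBr normrM sg1 mul1r.
  by rewrite -[d]add0r; apply: min_lipschitz; rewrite ?subrr ?normr0.
set b := Num.max _ _; set b' := Num.max _ _.
have bb : `|b - b'| <= d.
  rewrite -[d]add0r; apply: max_lipschitz; rewrite ?subrr ?normr0 //.
  rewrite -[d]add0r; apply: min_lipschitz; rewrite ?subrr ?normr0 //.
  by rewrite (_ : _ - _ = s' - s) 1?distrC //; ring.
have [b0 b1] : 0 <= b /\ b <= 1.
  by rewrite /b le_max lexx /= ge_max ler01 ge_min lexx.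
rewrite (_ : _ - _ = (x i - y i) * b + y i * (b - b')); last by ring.
apply: le_trans (ler_normD _ _) _; rewrite !normrM; apply: lerD.
  by rewrite -[e]mulr1; apply: ler_pM => //; rewrite ger0_norm.
by rewrite -[d]mul1r; apply: ler_pM.
Qed.

(** Every stage is compared with the original points, so errors do not accumulate: by [shrink_close]
    closeness grows only by one time step, and any [e'] above [e] is reached. *)
Lemma hemisphere_bounds (sg : R) N m e e' (z : chain F (nat -> R)) :
  `|sg| = 1 -> 0 <= e -> e < e' -> cycle_chain z ->
  sat (fine [pred x | cube N.+1 x && (0 <= sg * x N)] (close e) m) z ->
  exists w : chain F (nat -> R),
    sat (fine (cube N.+1) (close e') m.+1) w /\ bounds z w.
Proof.
move=> sg1 e0 ee' zc zS.
have sgsg : sg * sg = 1.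
  by rewrite -expr2 -(real_normK (num_real sg)) sg1 expr1n.
(* Time runs from 0 to 2 in [2 * J] steps of length 1 / J, which is at most [e' - e]. *)
pose J := (Num.truncn (e' - e)^-1).+1.
have J0 : 0 < J%:R :> R by rewrite ltr0n.
have Je : J%:R^-1 <= e' - e.
  rewrite -[leRHS]invrK lef_pV2 ?posrE ?invr_gt0 ?subr_gt0 //.
  exact/ltW/truncnS_gt.
have xN1 x : cube N.+1 x -> sg * x N <= 1.
  move=> /asboolP[x1 _ _]; apply: le_trans (ler_norm _) _.
  by rewrite normrM sg1 mul1r.
have m12 : Num.min 1 2 = 1 :> R by apply/min_idPl; rewrite ler1n.
pose x0 (i : nat) : R := if i == N then sg else 0.
apply: (@contraction_bounds _ _ _ (cube N.+1) _ (close e')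
  (fun j => shrink sg N (j%:R / J%:R)) (2 * J)%N x0 _ _ _ _ _ _ _ _ zc zS).
- move=> x /andP[xS xN]; apply/funext => i; rewrite /shrink mul0r subr0.
  rewrite (min_idPr ler01) (max_idPl xN) mulrA sgsg mul1r.
  rewrite m12 (max_idPr ler01) mulr1.
  by case: eqP => // ->.
- move=> x /andP[/xN1 xS xN]; apply/funext => i.
  rewrite /shrink natrM mulfK ?(lt0r_neq0 J0) //.
  rewrite m12 (max_idPr xS) mulr1 /x0; case: eqP => // _.
  by rewrite subrr (min_idPr ler01) maxxx mulr0.
- apply/asboolP; split=> [i||i Ni].
  + by rewrite /x0; case: eqP; rewrite ?sg1 ?normr0.
  + by exists N => //; rewrite /x0 eqxx.
  + by rewrite /x0 gtn_eqF.
- by apply/asboolP => i; rewrite subrr normr0 (le_trans e0 (ltW ee')).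
- by move=> j x /andP[xS xN]; apply: shrink_cube => //; rewrite divr_ge0.
- move=> j x y /andP[xS xN] /andP[yS yN] xy.
  have sub : subrel (close (e + J%:R^-1)) (close e').
    by apply: close_sub; rewrite -lerBrDl.
  have sj : j.+1%:R / J%:R - j%:R / J%:R = J%:R^-1 :> R.
    by rewrite -mulrBl -natrB // subSnn mul1r.
  have Ji : 0 <= J%:R^-1 :> R by rewrite invr_ge0.
  have Jn : `|J%:R^-1| <= J%:R^-1 :> R by rewrite ger0_norm.
  split; apply/sub/shrink_close => //; rewrite ?subrr ?normr0 //.
    by rewrite distrC sj.
  by rewrite sj.
Qed.

(** A small tuple may straddle the equator; moving the points near the equator onto it puts every
    tuple on one side. The map is discontinuous, but it displaces points by at most [d], and this is
    all that prisms require. *)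
Definition squash d N x : nat -> R := fun i =>
  if (i == N) && (`|x N| <= d) then 0 else x i.

Lemma squash_cube d N x : d < 1 -> cube N.+1 x -> cube N.+1 (squash d N x).
Proof.
move=> d1 /asboolP[x1 [i iN xi] x0]; apply/asboolP; split.
- by move=> j; rewrite /squash; case: ifP; rewrite ?normr0.
- exists i => //; rewrite /squash; case: ifP => // /andP[/eqP iE].
  by rewrite -iE xi leNgt d1.
- by move=> j Nj; rewrite /squash; case: ifP => // _; apply: x0.
Qed.

Lemma squash_close d N x : 0 <= d -> close d x (squash d N x).
Proof.
move=> d0; apply/asboolP => i; rewrite /squash; case: ifP => [/andP[/eqP -> ?]|_].
  by rewrite subr0.
by rewrite subrr normr0.
Qed.

Lemma close_sym e : symmetric (close e).
Proof.
by move=> x y; apply/asboolP/asboolP => xy i; rewrite distrC.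
Qed.

Lemma close_trans e e' x y z : close e x y -> close e' y z -> close (e + e') x z.
Proof.
move=> /asboolP xy /asboolP yz; apply/asboolP => i.
by rewrite -(subrKA (y i)); apply: le_trans (ler_normD _ _) (lerD _ _).
Qed.

(** If one point is above height [d], closeness keeps the others above 0. Otherwise all heights are
    at most [d], and the positive ones are squashed to 0. *)
Lemma squash_sides d N m s : 0 <= d -> fine (cube N.+1) (close d) m s ->
  all (fun x : nat -> R => 0 <= x N) (map (squash d N) s) \/
  all (fun x : nat -> R => x N <= 0) (map (squash d N) s).
Proof.
move=> d0 /fineP[_ _ es].
have [/hasP[x xs xN]|/hasPn H] := boolP (has (fun x => d < x N) s).
  left; rewrite all_map; apply/allP => y ys /=; rewrite /squash eqxx.
  have /asboolP/(_ N) := es _ _ xs ys; case: ifP => //= _.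
  by rewrite ler_norml => /andP[? ?]; lra.
right; rewrite all_map; apply/allP => y ys /=; rewrite /squash eqxx /=.
have := H _ ys; rewrite -leNgt; case: ifP => // /negbT; rewrite -ltNge.
by rewrite ltr_normr => /orP[] ? ?; lra.
Qed.

Lemma squash_fine d N m s : 0 <= d -> d < 1 -> fine (cube N.+1) (close d) m s ->
  fine (cube N.+1) (close (d + d + d)) m (map (squash d N) s).
Proof.
move=> d0 d1; apply: fine_map => [x|x y _ _ xy]; first exact: squash_cube.
apply: close_trans (squash_close _ _ d0); apply: close_trans xy.
by rewrite close_sym; apply: squash_close.
Qed.

(* The common boundary of the two halves of a cycle lies in the equator, which
   by induction bounds a small chain there; adding it closes up both halves. *)
Theorem cube_fill N m e : (m < N)%N -> 0 < e ->
  exists2 d, 0 < d & forall z : chain F (nat -> R), cycle_chain z ->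
    sat (fine (cube N) (close d) m) z ->
    exists w : chain F (nat -> R),
      sat (fine (cube N) (close e) m.+1) w /\ bounds z w.
Proof.
elim: N m e => // N IH [|m] e mN e0.
  exists 1 => // z zc zS; pose x0 (i : nat) : R := (i == N)%:R.
  exists (cone x0 z); split; last exact: cone_bounds.
  apply: sat_cone zS _ => s /fineP[/size0nil-> _ _]; apply/fineP; split=> // x.
    rewrite inE => /eqP->; apply/asboolP; split=> [i||i Ni].
    - by rewrite /x0; case: eqP; rewrite ?normr1 ?normr0.
    - by exists N => //; rewrite /x0 eqxx normr1.
    - by rewrite /x0 gtn_eqF.
  move=> y; rewrite !inE => -> ->; apply/asboolP => i.
  by rewrite subrr normr0 ltW.
have e20 : 0 < e / 2 by rewrite divr_gt0.
have [d1 d10 IHd] := IH m (e / 2) mN e20.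
(* Squashing two [d]-close points leaves them [d + d + d]-close. This has to be at most [d1] to fill
   in the equator and below [e / 2] to contract hemispheres within [e]; [d < 1] protects the
   coordinates of absolute value 1. *)
pose d := Num.min (Num.min (d1 / 3) (e / 8)) (1 / 2).
have [d0 dd1 de d12] : [/\ 0 < d, d + d + d <= d1, d + d + d < e / 2 & d < 1].
  have: d <= d1 / 3 by rewrite /d !ge_min lexx.
  have: d <= e / 8 by rewrite /d !ge_min lexx orbT.
  have: d <= 1 / 2 by rewrite /d !ge_min lexx orbT.
  by split; try lra; rewrite /d !lt_min; apply/andP; split; [apply/andP; split|]; lra.
exists d => // z zc zS; pose d3 := d + d + d.
have [w0 [w0S w0b]] : exists w0 : chain F (nat -> R),
    sat (fine (cube N.+1) (close e) m.+2) w0 /\ forall phi,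
    ev phi (push (squash d N) z) - ev phi (push id z) = ev (cob phi) w0.
  apply: homotopy_fine zc zS => [x xS|x y xS yS xy].
    by split=> //; apply: squash_cube.
  have xx' := squash_close N x (ltW d0); have yy' := squash_close N y (ltW d0).
  have /close_sub sub2 : d + d <= e by lra.
  have /close_sub sub3 : d3 <= e by rewrite /d3; lra.
  have /close_sub sub1 : d <= e by lra.
  split; first exact: sub1.
  - apply/sub3/(close_trans _ yy')/(close_trans _ xy).
    by rewrite close_sym.
  - exact/sub2/(close_trans xy).
  - by apply/sub2/(close_trans _ xy); rewrite close_sym.
pose z1 := push (squash d N) z.
pose ge0 (x : nat -> R) := 0 <= x N; pose le0 (x : nat -> R) := x N <= 0.
have z1S : sat (predI (fine (cube N.+1) (close d3) m.+1)
    (predU (all ge0) (all le0))) z1.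
  apply: sat_push zS _ => s sS; apply/andP; split.
    by apply: squash_fine => //; apply: ltW.
  by case: (squash_sides (ltW d0) sS) => H; apply/orP; [left|right].
pose zp := restr (all ge0) z1; pose zn := restr (predC (all ge0)) z1.
have z1c : cycle_chain z1 by apply: push_cycle.
have zpn f : ev f (bd zp) = - ev f (bd zn).
  by apply/eqP; rewrite -addr_eq0 !ev_bd -ev_split z1c.
have zpS : sat (predI (fine (cube N.+1) (close d3) m.+1) (all ge0)) zp.
  by apply: sat_sub (sat_restr _ z1S) => s /= /andP[/andP[-> _] ->].
have znS : sat (predI (fine (cube N.+1) (close d3) m.+1) (all le0)) zn.
  apply: sat_sub (sat_restr _ z1S) => s /= /andP[/andP[-> /orP[->|->]]] //.
have bdS (P : pred (nat -> R)) (c : chain F (nat -> R)) :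
    sat (predI (fine (cube N.+1) (close d3) m.+1) (all P)) c ->
    sat (predI (fine (cube N.+1) (close d3) m) (all P)) (bd c).
  move=> cS; apply: sat_bd cS _ => s t /andP[sS /allP sP] ts st; apply/andP.
  by split; [apply: fine_face sS ts st|apply/allP => x /ts/sP].
(* The formal sum [bd zp] may contain tuples off the equator that cancel. Since it pairs like
   [- bd zn], which is supported below the equator, dropping the tuples that are not below changes
   no pairing. *)
pose y := restr (all le0) (bd zp).
have yE f : ev f y = ev f (bd zp).
  rewrite ev_restr !zpn; congr (- _).
  by apply: eq_ev (bdS _ _ znS) _ => s /andP[_ ->].
have yS : sat (fine (cube N) (close d1) m) y.
  apply: sat_sub (sat_restr (all le0) (bdS _ _ zpS)) => s /=.
  move=> /andP[/andP[sS /allP s0] /allP s0'].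
  case/fineP: sS => sm Ss es; apply/fineP; split=> // [x xs|x x' xs xs'].
    apply: cube_equator; first exact: Ss.
    by apply/eqP; rewrite eq_le; apply/andP; split; [exact: s0'|exact: s0].
  by apply: close_sub dd1 _ _ _; apply: es.
have yc : cycle_chain y by move=> f; rewrite yE ev_bd eq_ev0 // => s; rewrite cob_cob.
have [v [vS vb]] := IHd y yc yS.
(* Applied to [zp] and to [oppc zn]: both have boundary [y], so subtracting the filling [v] of [y]
   makes cycles of them. *)
have half sg (c : chain F (nat -> R)) : `|sg| = 1 ->
    (forall f, ev (cob f) c = ev f y) ->
    sat (predI (fine (cube N.+1) (close d3) m.+1) (all [pred x | 0 <= sg * x N])) c ->
    exists w : chain F (nat -> R),
      sat (fine (cube N.+1) (close e) m.+2) w /\ bounds (c ++ oppc v) w.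
  move=> sg1 cb cS; apply: (@hemisphere_bounds sg N _ (e / 2)) => //; try lra.
    by move=> f; rewrite ev_cat ev_oppc cb vb subrr.
  rewrite sat_cat sat_oppc; apply/andP; split.
    apply: sat_sub cS => s /andP[/fineP[sm Ss es] /allP s0]; apply/fineP.
    split=> // [x xs|x x' xs xs']; first by apply/andP; split; [exact: Ss|exact: s0].
    by apply: close_sub (ltW de) _ _ _; apply: es.
  apply: sat_sub vS => s; apply: fine_sub => // x xN.
  rewrite /= cubeS //; move/asboolP: xN => [_ _ ->] //.
  by rewrite mulr0 lexx.
have [wp [wpS wpb]] : exists w : chain F (nat -> R),
      sat (fine (cube N.+1) (close e) m.+2) w /\ bounds (zp ++ oppc v) w.
  apply: half (normr1 _) _ _ => [f|]; first by rewrite yE ev_bd.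
  by apply: sat_sub zpS => s /andP[sS sp]; rewrite /= sS; apply: sub_all sp => x /=;
    rewrite mul1r.
have [wn [wnS wnb]] : exists w : chain F (nat -> R),
      sat (fine (cube N.+1) (close e) m.+2) w /\ bounds (oppc zn ++ oppc v) w.
  apply: half (normrN1 _) _ _ => [f|].
    by rewrite yE zpn ev_bd ev_oppc.
  rewrite sat_oppc.
  by apply: sat_sub znS => s /andP[sS sp]; rewrite /= sS; apply: sub_all sp => x /=;
    rewrite mulN1r oppr_ge0.
(* The two copies of [v] cancel in (zp - v) - (- zn - v) = zp + zn, and [w0] undoes the
   squashing. *)
exists (wp ++ oppc wn ++ oppc w0); split.
  by rewrite !sat_cat !sat_oppc wpS wnS.
move=> f; rewrite !ev_cat !ev_oppc -wpb -wnb -w0b !ev_cat !ev_oppc -/z1.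
rewrite (ev_split (all ge0) f z1) -/zp -/zn ev_push.
have -> : ev f z = ev (fun s => f (map id s)) z.
  by apply: eq_ev_fun => s; rewrite map_id.
ring.
Qed.
End Cube.

(** * Uniform radii on compact spaces *)

Section CompactMetric.
Variables (R : realType) (X : pseudoMetricType R).

(** The common core of uniform continuity and of Lebesgue numbers: a radius [d] valid at [x] yields
    all radii up to [d / 2] on the ball of radius [d / 2], so compactness gives one radius for all
    points. *)
Lemma compact_uniform_radius (P : R -> X -> Prop) :
  compact [set: X] ->
  (forall d e x y, 0 < e -> e <= d / 2 -> ball x (d / 2) y -> P d x -> P e y) ->
  (forall x, exists2 d, 0 < d & P d x) ->
  exists2 d, 0 < d & forall x, P d x.
Proof.
move=> /compact_near_coveringP cX Pmono Pex.
have near_P x : [set: X] x -> \forall x' \near x & e \near 0^'+, P e x'.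
  move=> _; have [d d0 Pd] := Pex x.
  have d20 : 0 < d / 2 by rewrite divr_gt0.
  exists (ball x (d / 2), [set e | 0 < e /\ e <= d / 2]); first split => /=.
  - exact: nbhsx_ballx.
  - apply: filterI; first exact: nbhs_right_gt.
    exact: nbhs_right_le.
  - by move=> [y e] /= [xy [e0 ed]]; apply: Pmono Pd.
have PX := cX _ _ _ (at_right_proper_filter (0 : R)) near_P.
have PX0 : \forall d \near 0^'+, [set: X] `<=` P d /\ 0 < d.
  by apply: filterI PX _; apply: nbhs_right_gt.
have [d [dP d0]] := @filter_ex _ _ (at_right_proper_filter (0 : R)) _ PX0.
by exists d => // x; apply: dP.
Qed.

Lemma compact_unif_continuous (T : finType) (f : T -> X -> X) e :
  compact [set: X] -> (forall t, continuous (f t)) -> 0 < e ->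
  exists2 d, 0 < d & forall x y, ball x d y -> forall t, ball (f t x) e (f t y).
Proof.
move=> cX fc e0; have e20 : 0 < e / 2 by rewrite divr_gt0.
have [|x|d d0 dP] := @compact_uniform_radius (fun d x => forall y y',
    ball x d y -> ball x d y' -> forall t, ball (f t y) e (f t y')) cX.
- move=> d d' x y d'0 dd xy H z z' yz yz'.
  have H' w : ball y d' w -> ball x d w.
    move=> yw; rewrite (splitr d); apply: ball_triangle xy _.
    exact: le_ball dd _ yw.
  by apply: H; apply: H'.
- have : \forall y \near x, forall t, ball (f t x) (e / 2) (f t y).
    apply: filter_forall => t; apply: fc; exact: nbhsx_ballx.
  move=> /nbhs_ballP[d /= d0 dP]; exists d => // y y' xy xy' t.
  rewrite (splitr e); apply: ball_triangle (dP _ xy' t).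
  by apply: ball_sym; apply: dP.
- exists d => // x y xy t; apply: dP xy t; exact: ballxx.
Qed.

(** The complements of the [C i] form an open cover; around each point, one of them contains a ball
    of radius [d]. *)
Lemma compact_lebesgue_number (I : finType) (C : I -> set X) :
  compact [set: X] -> (forall i, closed (C i)) ->
  (forall x, exists i, ~ C i x) ->
  exists2 d, 0 < d & forall x, exists i, forall y, ball x d y -> ~ C i y.
Proof.
move=> cX Ccl Cx; apply: compact_uniform_radius => // [d e x y e0 ed xy [i iP]|x].
  exists i => z yz; apply: iP; rewrite (splitr d); apply: ball_triangle xy _.
  exact: le_ball ed _ yz.
have [i nCx] := Cx x.
have /nbhs_ballP[d d0 dP] : nbhs x (~` C i).
  by apply: open_nbhs_nbhs; split=> //; apply: closed_openC.
by exists d => //; exists i.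
Qed.
End CompactMetric.

(** * Compactness of the sphere *)

Section Sphere.
Variables (R : realType) (n : nat).
Notation S := (sphere R n).

Lemma continuous_sumsq : continuous (fun x : 'rV[R]_n.+1 =>
  \sum_(i < n.+1) x ord0 i ^+ 2 : R).
Proof.
move=> x; elim: (index_enum _) => [|i r IH].
  rewrite (_ : (fun _ => _) = fun=> 0); first exact: cst_continuous.
  by apply/funext => y; rewrite big_nil.
rewrite (_ : (fun _ => _) =
  fun y : 'rV[R]_n.+1 => y ord0 i ^+ 2 + \sum_(j <- r) y ord0 j ^+ 2); last first.
  by apply/funext => y; rewrite big_cons.
by apply: continuousD IH; apply: continuousM; apply: coord_continuous.
Qed.

Lemma rv_norm_leP (v : 'rV[R]_n.+1) e : 0 <= e ->
  reflect (forall i, `|v ord0 i| <= e) (`|v| <= e).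
Proof.
move=> e0; rewrite [`|v|]/Num.Def.normr /= mx_normrE.
apply: (iffP idP) => [ve i|ve].
  apply: le_trans ve; exact: (le_bigmax _ (fun i => `|v i.1 i.2|) (ord0, i)).
by apply: bigmax_le => // -[j i] _ /=; rewrite ord1.
Qed.

Lemma sphere_coord (x : S) i : `|val x ord0 i| <= 1.
Proof.
case: x => v /= /[!inE] /= v1; rewrite -(@expr_le1 _ 2) // real_normK ?num_real //.
by rewrite -v1 (bigD1 i) //= lerDl sumr_ge0 // => j _; rewrite sqr_ge0.
Qed.

Lemma sphere_compact : compact [set: S].
Proof.
have cS : compact (S : set 'rV[R]_n.+1).
  apply: bounded_closed_compact; last first.
    apply: (@preimage_closed _ _ (fun x : 'rV[R]_n.+1 => \sum_(i < n.+1) x ord0 i ^+ 2)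
      [set 1]); last exact: closed_eq.
    by move=> x _; apply: continuous_sumsq.
  exists 1; split; first exact: num_real.
  move=> M M1 x xS; have M0 : 0 <= M by rewrite ltW // (lt_trans _ M1).
  apply/rv_norm_leP => // i; apply: le_trans (ltW M1).
  exact: (sphere_coord (exist _ x (mem_set xS))).
(* From the compact subset to the subspace type: push the filter forward along [val] and lift its
   cluster point. *)
move=> F PF _.
have FS : (val @ F) (S : set 'rV[R]_n.+1).
  by apply: (@filterS _ F _ setT) => [x _|]; [apply: (set_valP x)|apply: filterT].
have [v [vS vF]] := cS _ (fmap_proper_filter val PF) FS.
exists (exist _ v (mem_set vS)); split=> // A B FA.
rewrite nbhsE /= => -[U [[V oV <-] Vv] UB].
have FvA : (val @ F) (val @` A) by apply: (@filterS _ F _ A) => // x Ax; exists x.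
have [w [[x Ax <-] Vw]] := vF _ V FvA (open_nbhs_nbhs (conj oV Vv)).
by exists x; split=> //; apply: UB.
Qed.
End Sphere.

(** * Small cycles on the Euclidean sphere *)

Section SphereFill.
Variables (R : realType) (n : nat) (F : comNzRingType).
Notation S := (sphere R n).

Definition ball_rel (X : pseudoMetricType R) (e : R) : rel X :=
  fun x y => `[< ball x e y >].

Lemma sphere_ballE (x y : S) e :
  ball x e y = (`|val x - val y| < e) :> Prop.
Proof. by rewrite -initial_ballE /= -ball_normE. Qed.

(** Serves both radial projections, with sup norms and with Euclidean lengths as denominators. *)
Lemma ratio_close (a b u v : R) : 0 < u -> 0 < v -> `|b| <= v ->
  `|a / u - b / v| <= (`|a - b| + `|u - v|) / u.
Proof.
move=> u0 v0 bv; have un : u != 0 by rewrite gt_eqF.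
have vn : v != 0 by rewrite gt_eqF.
have -> : a / u - b / v = (a - b) / u + (b / v) * ((v - u) / u).
  by field; rewrite un vn.
apply: le_trans (ler_normD _ _) _; rewrite [leRHS]mulrDl !normrM.
have uV : `|u^-1| = u^-1 by rewrite ger0_norm // invr_ge0 ltW.
rewrite uV [`|v - u|]distrC lerD2l -[leRHS]mul1r.
apply: ler_wpM2r; first by rewrite mulr_ge0 // invr_ge0 ltW.
by rewrite normrV ?unitfE // (gtr0_norm v0) ler_pdivrMr // mul1r.
Qed.

(** Radial projection to the boundary of the cube, by division by the sup norm. *)
Definition to_cube (x : S) : nat -> R :=
  fun i => if (i < n.+1)%N then val x ord0 (inord i) / `|val x| else 0.

Definition len (y : nat -> R) : R := Num.sqrt (\sum_(i < n.+1) y i ^+ 2).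

(** The inverse radial projection. The default [x0] never occurs on the cube, by [val_of_cube]. *)
Definition of_cube (x0 : S) (y : nat -> R) : S :=
  insubd x0 (\row_(i < n.+1) (y i / len y)).

Lemma sphere_sumsq (x : S) : \sum_(i < n.+1) val x ord0 i ^+ 2 = 1.
Proof. exact: (set_valP x). Qed.

Lemma coord_le_norm (v : 'rV[R]_n.+1) i : `|v ord0 i| <= `|v|.
Proof. exact/rv_norm_leP. Qed.

(** Each square is at most the sup norm because coordinates are at most 1, and the n + 1 squares add
    up to 1. *)
Lemma sphere_norm_ge (x : S) : n.+1%:R^-1 <= `|val x|.
Proof.
have K0 : 0 < n.+1%:R :> R by rewrite ltr0n.
rewrite leNgt; apply/negP => xK.
have: 1 <= \sum_(i < n.+1) `|val x|.
  rewrite -(sphere_sumsq x); apply: ler_sum => i _.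
  rewrite -(@real_normK _ (val x ord0 i)) ?num_real // expr2.
  rewrite -[leRHS]mul1r; apply: ler_pM => //; first exact: sphere_coord.
  exact: coord_le_norm.
rewrite sumr_const card_ord -[_ *+ _]mulr_natl leNgt => /negP; apply.
by rewrite -ltr_pdivlMl // mulr1.
Qed.

Lemma sphere_norm_gt0 (x : S) : 0 < `|val x|.
Proof. by apply: lt_le_trans (sphere_norm_ge x); rewrite invr_gt0 ltr0n. Qed.

Lemma to_cube_cube (x : S) : cube n.+1 (to_cube x).
Proof.
have x0 := sphere_norm_gt0 x.
have xE i : `|val x ord0 i / `|val x| | = `|val x ord0 i| / `|val x|.
  by rewrite normrM normrV ?unitfE ?gt_eqF // normr_id.
apply/asboolP; split=> [i||i ni].
- rewrite /to_cube; case: ifP => _; last by rewrite normr0.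
  by rewrite xE ler_pdivrMr // mul1r coord_le_norm.
- have [|[j i] xi] := @mx_norm_neq0 R _ _ (val x).
    by rewrite gt_eqF.
  exists i => //; rewrite /to_cube ltn_ord inord_val xE.
  have xE' : `|val x| = `|val x ord0 i| by rewrite [LHS]xi /= [j]ord1.
  by rewrite -xE' divff // gt_eqF.
- by rewrite /to_cube ltnNge ni.
Qed.

Lemma to_cube_close (x y : S) d : ball x d y ->
  close (2 * n.+1%:R * d) (to_cube x) (to_cube y).
Proof.
rewrite sphere_ballE => xy; have d0 : 0 <= d by apply: le_trans (ltW xy).
apply/asboolP => i; rewrite /to_cube; case: ifP => _; last first.
  by rewrite subrr normr0 !mulr_ge0.
apply: le_trans (ratio_close _ (sphere_norm_gt0 x) (sphere_norm_gt0 y)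
  (coord_le_norm _ _)) _.
have dist2 : `|val x ord0 (inord i) - val y ord0 (inord i)| +
    `| `|val x| - `|val y| | <= 2 * d.
  rewrite mulr2n mulrDl mul1r; apply: lerD.
    have := coord_le_norm (val x - val y) (inord i); rewrite !mxE => /le_trans.
    by apply; apply: ltW.
  by apply: le_trans (ler_dist_dist _ _) (ltW xy).
have invx : `|val x|^-1 <= n.+1%:R.
  rewrite -[leRHS]invrK lef_pV2 ?posrE ?invr_gt0 ?ltr0n ?sphere_norm_gt0 //.
  exact: sphere_norm_ge.
rewrite mulrAC; apply: (ler_pM _ _ dist2 invx); first by rewrite addr_ge0.
by rewrite invr_ge0 ltW // sphere_norm_gt0.
Qed.

Lemma len_sq (y : nat -> R) : len y ^+ 2 = \sum_(i < n.+1) y i ^+ 2.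
Proof. by rewrite sqr_sqrtr // sumr_ge0 // => i _; rewrite sqr_ge0. Qed.

Lemma coord_le_len (y : nat -> R) i : (i < n.+1)%N -> `|y i| <= len y.
Proof.
move=> ni; rewrite -sqrtr_sqr; apply: ler_wsqrtr.
rewrite (bigD1 (Ordinal ni)) //= lerDl sumr_ge0 // => j _; exact: sqr_ge0.
Qed.

Lemma len_ge1 (y : nat -> R) : cube n.+1 y -> 1 <= len y.
Proof. by move=> /asboolP[_ [i ni <-] _]; apply: coord_le_len. Qed.

Lemma val_of_cube (x0 : S) (y : nat -> R) : cube n.+1 y ->
  val (of_cube x0 y) = \row_(i < n.+1) (y i / len y).
Proof.
move=> /len_ge1 y1; rewrite val_insubd mem_set // /sphere /=.
under eq_bigr => i _ do rewrite mxE expr_div_n.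
rewrite -mulr_suml -len_sq divff // expf_neq0 // gt_eqF //.
exact: lt_le_trans ltr01 y1.
Qed.

Lemma of_to_cube (x0 x : S) : of_cube x0 (to_cube x) = x.
Proof.
apply: val_inj; rewrite val_of_cube; last exact: to_cube_cube.
have xn := sphere_norm_gt0 x.
have -> : len (to_cube x) = `|val x|^-1.
  rewrite /len; under eq_bigr => i _ do rewrite /to_cube ltn_ord inord_val expr_div_n.
  by rewrite -mulr_suml sphere_sumsq mul1r -exprVn sqrtr_sqr ger0_norm // invr_ge0.
apply/rowP => i; rewrite mxE /to_cube ltn_ord inord_val invrK divfK //.
by rewrite gt_eqF.
Qed.

Lemma of_cube_close (x0 : S) (y y' : nat -> R) d e :
  cube n.+1 y -> cube n.+1 y' -> close d y y' -> 0 <= d ->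
  (n.+1%:R + 1) * d < e -> ball (of_cube x0 y) e (of_cube x0 y').
Proof.
move=> yc yc' /asboolP yy d0 de; rewrite sphere_ballE !val_of_cube //.
apply: le_lt_trans de; apply/rv_norm_leP => [|i]; first by rewrite mulr_ge0 // addr_ge0.
rewrite !mxE; have [y1 y1'] := (len_ge1 yc, len_ge1 yc').
have y0 : 0 < len y by apply: lt_le_trans y1.
have y0' : 0 < len y' by apply: lt_le_trans y1'.
have s0 : 0 < len y + len y' by rewrite addr_gt0.
(* Multiply by the sum of the lengths, which is at least 2: the difference of squares becomes a sum
   of n + 1 terms, each at most [d * 2]. *)
have lens : `|len y - len y'| <= n.+1%:R * d.
  rewrite -(ler_pM2r s0); have -> : `|len y - len y'| * (len y + len y') =
      `|\sum_(i < n.+1) (y i - y' i) * (y i + y' i)|.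
    rewrite -[X in _ * X]ger0_norm ?(ltW s0) // -normrM -subr_sqr !len_sq -sumrB.
    by congr `| _ |; apply: eq_bigr => j _; rewrite subr_sqr.
  have yb j : `|y j| <= 1 by move/asboolP: yc => [].
  have yb' j : `|y' j| <= 1 by move/asboolP: yc' => [].
  apply: le_trans (ler_norm_sum _ _ _) _.
  apply: (@le_trans _ _ (\sum_(i < n.+1) d * 2)).
    apply: ler_sum => j _; rewrite normrM; apply: ler_pM => //.
    by apply: le_trans (ler_normD _ _) (lerD (yb j) (yb' j)).
  rewrite sumr_const card_ord -[d * 2 *+ _]mulr_natl -mulrA.
  by do 2 apply: ler_wpM2l => //; apply: (lerD y1 y1').
apply: le_trans (ratio_close _ y0 y0' (coord_le_len _ _)) _ => //.
have lensum : `|y i - y' i| + `|len y - len y'| <= (n.+1%:R + 1) * d.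
  by rewrite mulrDl mul1r addrC; apply: lerD.
rewrite -[leRHS]mulr1; apply: (ler_pM _ _ lensum); first by rewrite addr_ge0.
  by rewrite invr_ge0 ltW.
by rewrite invf_le1.
Qed.

Lemma sphere_nonempty : [set: S] !=set0.
Proof.
suff xS : (\row_(i < n.+1) (i == ord0)%:R : 'rV[R]_n.+1) \in S by exists (SigSub xS).
apply: mem_set.
rewrite /sphere /= (bigD1 ord0) //= mxE eqxx expr1n big1 ?addr0 // => i /negPf i0.
by rewrite mxE i0 expr0n.
Qed.

(** Both radial projections are Lipschitz, and their composite on the sphere is exactly the
    identity, so the transported filling bounds [z] itself without a further homotopy. *)
Lemma sphere_fill m e : (m < n.+1)%N -> 0 < e ->
  exists2 d, 0 < d & forall z : chain F S, cycle_chain z ->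
    sat (fine predT (@ball_rel _ d) m) z ->
    exists w : chain F S,
      sat (fine predT (@ball_rel _ e) m.+1) w /\ bounds z w.
Proof.
move=> mn e0; pose K : R := n.+1%:R; have K0 : 0 < K by rewrite ltr0n.
have K10 : 0 < K + 1 by rewrite addr_gt0.
(* [of_cube] costs a factor [K + 1]; the additional 2 gives the strict inequality of open balls. *)
pose e1 := e / (2 * (K + 1)); have e10 : 0 < e1 by rewrite divr_gt0 // mulr_gt0.
have [d1 d10 fill] := @cube_fill R F n.+1 m e1 mn e10.
exists (d1 / (2 * K)) => [|z zc zS]; first by rewrite divr_gt0 // mulr_gt0.
have [x0 _] := sphere_nonempty.
have [||w [wS wb]] := fill (push to_cube z) _ _.
- exact: push_cycle.
- apply: sat_push zS _ => s; apply: fine_map => [x _|x y _ _ /asboolP xy].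
    exact: to_cube_cube.
  by have := to_cube_close xy; rewrite mulrC divfK // mulf_neq0 // gt_eqF.
exists (push (of_cube x0) w); split.
  apply: sat_push wS _ => s; apply: fine_map => // x y xc yc xy; apply/asboolP.
  apply: of_cube_close xc yc xy (ltW e10) _.
  rewrite -/K (_ : (K + 1) * e1 = e / 2); first by lra.
  by rewrite /e1; field; rewrite gt_eqF.
move=> f; rewrite -(push_bounds _ wb).
rewrite !ev_push; apply: eq_ev zS _ => s _; congr f.
by rewrite -map_comp -[LHS]map_id; apply: eq_map => x /=; rewrite of_to_cube.
Qed.
End SphereFill.

(** * The group ring of the cyclic group acting on chains and cochains *)

Section GroupRing.
Variable p : nat.

(** Multiplication in the group algebra, whose elements are functions: ['Z_p] is at once the group
    and the coefficient ring. *)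
Definition group_conv (k l : 'Z_p -> 'Z_p) (g : 'Z_p) : 'Z_p :=
  \sum_(h : 'Z_p) k h * l (g - h).

(* The elements g - 1, \sum_g g and \sum_j - j g^j of the group ring, where g
   is the generator of the cyclic group: the product of the first and the last
   one is the second one, since p = 0 in the coefficient ring. *)
Definition kdiff (g : 'Z_p) : 'Z_p := (g == 1)%:R - (g == 0)%:R.
Definition knorm (g : 'Z_p) : 'Z_p := 1.
Definition kquot (g : 'Z_p) : 'Z_p := - g.

Lemma sum_delta (l : 'Z_p -> 'Z_p) a : \sum_(h : 'Z_p) (h == a)%:R * l h = l a.
Proof.
rewrite (bigD1 a) //= eqxx mul1r big1 ?addr0 // => h /negPf ->.
by rewrite mul0r.
Qed.

Lemma conv_diff l g : group_conv kdiff l g = l (g - 1) - l g.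
Proof.
rewrite /group_conv /kdiff; under eq_bigr => h _ do rewrite mulrBl.
rewrite sumrB (sum_delta (fun h => l (g - h))).
by rewrite (sum_delta (fun h => l (g - h))) subr0.
Qed.

Lemma conv_comm k l g : group_conv k l g = group_conv l k g.
Proof.
rewrite /group_conv (reindex_inj (inj_comp (addrI g) oppr_inj)) /=.
by apply: eq_bigr => h _; rewrite mulrC subKr.
Qed.

Lemma conv_diff_quot g : group_conv kdiff kquot g = knorm g.
Proof. by rewrite conv_diff /kquot /knorm opprB opprK subrK. Qed.

Lemma conv_diff_norm g : group_conv kdiff knorm g = 0.
Proof. by rewrite conv_diff subrr. Qed.

Variables (X : eqType) (act : 'Z_p -> X -> X).
Hypothesis act_add : forall g h x, act g (act h x) = act (g + h) x.
Hypothesis act0 : forall x, act 0 x = x.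

Definition gop (k : 'Z_p -> 'Z_p) (f : cochain 'Z_p X) : cochain 'Z_p X :=
  fun s => \sum_(g : 'Z_p) k g * f (map (act g) s).

Definition gact (k : 'Z_p -> 'Z_p) : chain 'Z_p X -> chain 'Z_p X :=
  bindc (fun s => [seq (k g, map (act g) s) | g <- index_enum 'Z_p]).

Lemma ev_gact k f c : ev f (gact k c) = ev (gop k f) c.
Proof.
by rewrite ev_bindc; apply: eq_ev_fun => s; rewrite /ev big_map.
Qed.

Lemma sat_gact k (P Q : pred (seq X)) c : sat P c ->
  (forall g s, P s -> Q (map (act g) s)) -> sat Q (gact k c).
Proof.
move=> cP PQ; apply: sat_bindc cP _ => s Ps.
by rewrite /sat all_map; apply/allP => g _; apply: PQ.
Qed.

Lemma gop_gop k l f s : gop k (gop l f) s = gop (group_conv k l) f s.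
Proof.
rewrite /gop; under eq_bigr => g _ do rewrite mulr_sumr.
under [RHS]eq_bigr => g _ do rewrite mulr_suml.
rewrite [RHS]exchange_big; apply: eq_bigr => g _ /=.
rewrite [RHS](reindex_inj (addrI g)); apply: eq_bigr => h _ /=.
rewrite mulrA addrC addKr; congr (_ * f _).
by rewrite -map_comp; apply: eq_map => x /=; rewrite act_add addrC.
Qed.

Lemma eq_gop k l f f' s : k =1 l ->
  (forall g, f (map (act g) s) = f' (map (act g) s)) ->
  gop k f s = gop l f' s.
Proof. by move=> kl ff; apply: eq_bigr => g _; rewrite kl ff. Qed.

Lemma gop_comm k l f s : gop k (gop l f) s = gop l (gop k f) s.
Proof. by rewrite !gop_gop; apply: eq_gop => // g; apply: conv_comm. Qed.

Lemma gop_diff f s : gop kdiff f s = f (map (act 1) s) - f s.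
Proof.
rewrite /gop /kdiff; under eq_bigr => g _ do rewrite mulrBl.
rewrite sumrB (sum_delta (fun h => f (map (act h) s))).
rewrite (sum_delta (fun h => f (map (act h) s))); congr (_ - f _).
by rewrite (eq_map act0) map_id.
Qed.

Lemma cob_gop k f s : cob (gop k f) s = gop k (cob f) s.
Proof. by rewrite /gop cob_sum; apply: eq_bigr => g _; rewrite cob_map. Qed.

Lemma gop_diff_quot f s : gop kdiff (gop kquot f) s = gop knorm f s.
Proof. by rewrite gop_gop; apply: eq_gop => // g; apply: conv_diff_quot. Qed.

Lemma gop_diff_norm f s : gop kdiff (gop knorm f) s = 0.
Proof.
rewrite gop_gop /gop big1 // => g _.
by rewrite conv_diff_norm mul0r.
Qed.

(** The differentials of the periodic resolution of a cyclic group; consecutive ones have product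
    zero. *)
Definition kparity m := if odd m then knorm else kdiff.

Lemma gop_parityS m f s : gop (kparity m) (gop (kparity m.+1) f) s = 0.
Proof.
rewrite /kparity /=; case: (odd m) => /=; last exact: gop_diff_norm.
by rewrite gop_comm gop_diff_norm.
Qed.

(** For even [m] the norm is g - 1 times [kquot], so it inherits the cycle property. With n = (p -
    1) d - 1 this parity occurs only for p = 2 and odd d. *)
Lemma gact_norm_cycle m c :
  cycle_chain (gact (kparity m) c) -> cycle_chain (gact knorm c).
Proof.
rewrite /kparity; case: (odd m) => // cc h; rewrite ev_gact.
rewrite (_ : ev _ c = ev (gop kdiff (gop kquot (cob h))) c); last first.
  by apply: eq_ev_fun => s; rewrite gop_diff_quot.
rewrite -ev_gact -[RHS](cc (gop kquot h)).
by apply: eq_ev_fun => s; rewrite cob_gop.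
Qed.

(** * Towers of fillings *)

Variables (R : realFieldType) (E : R -> rel X) (n : nat) (e0 : R).
Hypothesis E_act : forall e g x y, E e x y -> E e (act g x) (act g y).
Hypothesis E_mono : forall e e', e <= e' -> subrel (E e) (E e').
Hypothesis E_refl : forall e x, 0 < e -> E e x x.

Notation small e m := (fine predT (E e) m).

Lemma small_mono e e' m s : e <= e' -> small e m s -> small e' m s.
Proof. by move=> /E_mono ee; apply: fine_sub. Qed.

Lemma small_act e m g s : small e m s -> small e m (map (act g) s).
Proof. by apply: fine_map => // x y _ _; apply: E_act. Qed.

Hypothesis E_fill : forall m e, (m < n.+1)%N -> 0 < e ->
  exists2 d, 0 < d & forall z : chain 'Z_p X, cycle_chain z -> sat (small d m) z ->
    exists w : chain 'Z_p X, sat (small e m.+1) w /\ bounds z w.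

(** The value 1 moves up by adjunction. For odd [k], [f k] against the norm of [x_k], which is the
    boundary of [x_(k+1)], equals [cob (f k)], the norm of [f k.+1], against [x_(k+1)]. For even
    [k], write the norm as g - 1 times [kquot], move g - 1 to [x_k], and recombine after the
    coboundary. *)
Lemma tower (f : nat -> cochain 'Z_p X) (x0 : X) k e :
  (forall x, gop knorm (f 0) [:: x] = 1) ->
  (forall k s, small e0 k.+2 s -> cob (f k) s = gop (kparity k) (f k.+1) s) ->
  (k <= n)%N -> 0 < e -> e <= e0 ->
  exists x, [/\ sat (small e k.+1) x, cycle_chain (gact (kparity k) x)
    & ev (gop knorm (f k)) x = 1].
Proof.
move=> f0 fS; elim: k e => [|k IH] e kn e_gt0 ee0.
  exists [:: (1, [:: x0])]; split.
  - by rewrite /sat /= andbT /fine /= allrel1l /= E_refl.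
  - move=> g; rewrite ev_gact ev1 mul1r gop_diff /=; ring.
  - by rewrite ev1 mul1r f0.
have [d d0 fill] := E_fill (kn : (k.+1 < n.+1)%N) e_gt0.
(* The scale of [x_k] is dictated by the filling that produces [x_(k+1)]. *)
have [||x [xS xc x1]] := IH (Num.min d e) (ltnW kn).
- by rewrite lt_min d0.
- by rewrite ge_min ee0 orbT.
have [|w [wS wb]] := fill _ xc.
  apply: sat_gact xS _ => g s /(small_act g).
  by apply: small_mono; rewrite ge_min lexx.
exists w; split => // [h|].
  rewrite ev_gact (_ : ev _ w = ev (cob (gop (kparity k.+1) h)) w); last first.
    by apply: eq_ev wS _ => s _; rewrite cob_gop.
  by rewrite -wb ev_gact eq_ev0 // => s; apply: gop_parityS.
have wE g : ev (gop g (cob (f k))) w = ev (gop g (gop (kparity k) (f k.+1))) w.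
  apply: eq_ev wS _ => s ws; apply: eq_gop => // h; apply: fS.
  exact/small_act/(small_mono ee0).
rewrite -[RHS]x1; case: (boolP (odd k)) => ok.
  have -> : knorm = kparity k by rewrite /kparity ok.
  rewrite -[RHS]ev_gact wb; apply: eq_ev wS _ => s /(small_mono ee0)/fS.
  by move=> ->.
have kE : kparity k = kdiff by rewrite /kparity (negPf ok).
have -> : ev (gop knorm (f k)) x = ev (gop kdiff (gop kquot (f k))) x.
  by apply: eq_ev xS _ => s _; rewrite gop_diff_quot.
rewrite -kE -[RHS]ev_gact wb.
have -> : ev (cob (gop kquot (f k))) w = ev (gop kquot (cob (f k))) w.
  by apply: eq_ev wS _ => s _; rewrite cob_gop.
rewrite wE kE; apply: eq_ev wS _ => s _.
by rewrite gop_comm gop_diff_quot.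
Qed.
End GroupRing.

Lemma gop_equivariant p (X Y : eqType) (actX : 'Z_p -> X -> X)
    (actY : 'Z_p -> Y -> Y) (l : X -> Y) k (f : cochain 'Z_p Y) s :
  (forall g x, l (actX g x) = actY g (l x)) ->
  gop actX k (fun t => f (map l t)) s = gop actY k f (map l s).
Proof.
move=> lE; apply: eq_bigr => g _; rewrite -!map_comp.
by congr (_ * f _); apply: eq_map => x /=; rewrite lE.
Qed.

(** * Alternating cochains *)

Section Alternating.
Variables (F : comNzRingType).
Implicit Types V W : eqType.

(** Vanishing on repetitions is a separate clause because the sign rule does not imply it when p =
    2. *)
Definition alternating V (f : cochain F V) :=
  (forall u x y w, f (u ++ x :: y :: w) = - f (u ++ y :: x :: w)) /\
  (forall u x w, f (u ++ x :: x :: w) = 0).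

Lemma alternating_cons V (f : cochain F V) x :
  alternating f -> alternating (fun t => f (x :: t)).
Proof.
move=> [f1 f2]; split=> [u y z w|u y w]; first exact: (f1 (x :: u)).
exact: (f2 (x :: u)).
Qed.

Lemma alternating_front V (f : cochain F V) u x w : alternating f ->
  f (u ++ x :: w) = (-1) ^+ size u * f (x :: u ++ w).
Proof.
elim: u f => [|y u IH] f fa /=; first by rewrite mul1r.
rewrite (IH (fun t => f (y :: t))); last exact: alternating_cons.
by rewrite ((fa.1) [::] y x) exprS mulN1r mulrN mulNr.
Qed.

Lemma alternating_not_uniq V (f : cochain F V) s : alternating f ->
  ~~ uniq s -> f s = 0.
Proof.
elim: s f => //= x s IH f fa; rewrite negb_and negbK => /orP[xs|su].
  case/splitPr: xs => u w.
  rewrite (@alternating_front _ (fun t => f (x :: t))); last exact: alternating_cons.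
  by rewrite ((fa.2) [::]) mulr0.
by rewrite (IH (fun t => f (x :: t))) //; apply: alternating_cons.
Qed.

Lemma alternating_map V W (h : V -> W) (f : cochain F W) :
  alternating f -> alternating (fun s => f (map h s)).
Proof.
by move=> [f1 f2]; split=> [u x y w|u x w]; rewrite !map_cat /=; [apply: f1|apply: f2].
Qed.

Lemma alternating_cob V (f : cochain F V) : alternating f -> alternating (cob f).
Proof.
move=> fa; split=> [u x y w|u x w].
  elim: u f fa => [|z u IH] f fa /=.
    have E : cob (fun t => f (x :: y :: t)) w = - cob (fun t => f (y :: x :: t)) w.
      rewrite -mulN1r -[RHS](@big_seq1 F 0 +%R _ tt (fun=> _ * cob _ w)) -cob_sum.
      by apply: eq_cob_fun => t; rewrite big_seq1 mulN1r; apply: (fa.1 [::]).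
    rewrite E; ring.
  rewrite (fa.1 u) (IH (fun t => f (z :: t))); last exact: alternating_cons.
  by rewrite opprB opprK addrC.
elim: u f fa => [|z u IH] f fa /=.
  rewrite (@cob0 _ _ (fun t => f (x :: x :: t))); first by rewrite subr0 subrr.
  by move=> t; apply: (fa.2 [::]).
rewrite (fa.2 u) (IH (fun t => f (z :: t))) ?subr0 //; exact: alternating_cons.
Qed.

Lemma alternating_mul V (c f : cochain F V) : (forall s t, s =i t -> c s = c t) ->
  alternating f -> alternating (fun s => c s * f s).
Proof.
move=> cE [f1 f2]; split=> [u x y w|u x w]; last by rewrite f2 mulr0.
rewrite f1 mulrN; congr (- (_ * _)); apply: cE => z.
by rewrite !mem_cat !inE; congr (_ || _); rewrite orbCA.
Qed.

(** Allows an identity to be checked with a chosen vertex at the head, where [cob] unfolds. *)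
Lemma alternating_eq_front V (f g : cochain F V) x s :
  alternating f -> alternating g -> x \in s ->
  (forall t, perm_eq s (x :: t) -> f (x :: t) = g (x :: t)) -> f s = g s.
Proof.
move=> fa ga /splitPr[u w] fg.
rewrite (alternating_front u x w fa) (alternating_front u x w ga) fg //.
by rewrite -cat1s perm_catCA.
Qed.
End Alternating.

(** * The join complex and its dual tower of cochains *)

Section Labels.
Variables (p d : nat) (p_prime : prime p).
Notation V := ('I_d * 'Z_p)%type.
Implicit Types (s : seq V) (v : V).

Definition vact (h : 'Z_p) (v : V) : V := (v.1, v.2 + h).

Lemma vact_add g h v : vact g (vact h v) = vact (g + h) v.
Proof. by rewrite /vact /= -addrA [h + g]addrC. Qed.

Lemma vact0 v : vact 0 v = v.
Proof. by case: v => i g; rewrite /vact /= addr0. Qed.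

Lemma mem_vact h s i g : ((i, g) \in map (vact h) s) = ((i, g - h) \in s).
Proof.
apply/mapP/idP => [[[j k] js [-> ->]]|gs]; first by rewrite addrK.
by exists (i, g - h) => //; rewrite /vact /= subrK.
Qed.

(* The simplices of the d-fold join of the boundary of a (p-1)-simplex. *)
Definition proper s : bool := [forall i : 'I_d, exists g : 'Z_p, (i, g) \notin s].

Lemma proper_sub s t : {subset t <= s} -> proper s -> proper t.
Proof.
move=> ts /forallP ps; apply/forallP => i; have /existsP[g gs] := ps i.
by apply/existsP; exists g; apply: contra gs => /ts.
Qed.

Lemma proper_act h s : proper s -> proper (map (vact h) s).
Proof.
move=> /forallP ps; apply/forallP => i; have /existsP[g gs] := ps i.
by apply/existsP; exists (g + h); rewrite mem_vact addrK.
Qed.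

Lemma Zp_trunc_prime : (Zp_trunc p).+2 = p.
Proof. by rewrite Zp_cast // prime_gt1. Qed.

(* The mean of the first nonempty column moves along with a simplex, hence
   the action on simplices is free. *)
Definition mean s : 'Z_p :=
  if [pick i : 'I_d | [exists g : 'Z_p, (i, g) \in s]] is Some i then
    (\sum_(g : 'Z_p | (i, g) \in s) g) / #|[pred g : 'Z_p | (i, g) \in s]|%:R
  else 0.

Lemma mean_eq_mem s t : s =i t -> mean s = mean t.
Proof.
move=> st; rewrite /mean.
have -> : [pick i : 'I_d | [exists g : 'Z_p, (i, g) \in s]] =
          [pick i : 'I_d | [exists g : 'Z_p, (i, g) \in t]].
  by apply: eq_pick => i; apply: eq_existsb => g; rewrite st.
case: pickP => // i _; congr (_ / _%:R); first by apply: eq_bigl => g; rewrite st.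
by apply: eq_card => g; rewrite !inE st.
Qed.

Lemma mean_act h s : proper s -> s != [::] -> mean (map (vact h) s) = mean s + h.
Proof.
move=> /forallP ps s0; rewrite /mean.
have -> : [pick i : 'I_d | [exists g : 'Z_p, (i, g) \in map (vact h) s]] =
          [pick i : 'I_d | [exists g : 'Z_p, (i, g) \in s]].
  apply: eq_pick => i; apply/existsP/existsP => -[g gs].
    by exists (g - h); rewrite -mem_vact.
  by exists (g + h); rewrite mem_vact addrK.
case: pickP => [i /existsP[g gs]|none]; last first.
  case: s s0 none {ps} => // -[i g] s _ /(_ i) /existsP[]; exists g.
  by rewrite inE eqxx.
set m := #|[pred g : 'Z_p | (i, g) \in s]|.
have -> : #|[pred g : 'Z_p | (i, g) \in map (vact h) s]| = m.
  rewrite /m -[RHS](fintype.card_image (addIr h)); apply: eq_card => k.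
  rewrite inE mem_vact.
  apply/idP/fintype.imageP => [ks|[j js ->]]; last by rewrite addrK.
  by exists (k - h); rewrite ?subrK.
(* The column is nonempty and not full, so 0 < m < p, and [m] is invertible modulo the prime p. *)
have m_unit : (m%:R : 'Z_p) \is a GRing.unit.
  rewrite unitZpE ?prime_gt1 // prime_coprime // gtnNdvd //.
    by apply/card_gt0P; exists g; rewrite inE.
  have /existsP[k ks] := ps i.
  rewrite /m -[X in (_ < X)%N]Zp_trunc_prime -[X in (_ < X)%N](card_ord (Zp_trunc p).+2).
  apply: proper_card; apply/properP; split; first exact/fintype.subsetP.
  by exists k; rewrite ?inE.
rewrite (reindex_inj (addIr h)) /=.
under eq_bigl => k do rewrite mem_vact addrK.
rewrite big_split /= sumr_const mulrDl; congr (_ + _).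
by rewrite -[h *+ _]mulr_natr -[X in _ * X%:R / _]/m mulrK.
Qed.

(** Divides an invariant cochain by the norm: exactly one translate of [s] has mean 0, so one term
    of the norm survives. *)
Lemma gop_norm_mean (b : cochain 'Z_p V) s : proper s -> s != [::] ->
  (forall g, b (map (vact g) s) = b s) ->
  gop vact (@knorm p) (fun t => (mean t == 0)%:R * b t) s = b s.
Proof.
move=> ps s0 bs; rewrite /gop /knorm -[RHS](sum_delta (fun=> b s) (- mean s)).
apply: eq_bigr => g _; rewrite mul1r bs mean_act // addrC addr_eq0.
by [].
Qed.

(** Divides by g - 1: [mean] identifies an orbit of simplices with Z/p, and these are the partial
    sums of [b] along the orbit, starting at the translate of mean 0. *)
Definition antidiff (b : cochain 'Z_p V) : cochain 'Z_p V := fun s =>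
  \sum_(j : 'Z_p | (j < mean s)%N) b (map (vact (j - mean s)) s).

Lemma Zp_partial_sums (B : 'Z_p -> 'Z_p) (r : 'Z_p) : \sum_j B j = 0 ->
  \sum_(j : 'Z_p | (j < (r + 1)%R)%N) B j - \sum_(j : 'Z_p | (j < r)%N) B j = B r.
Proof.
move=> B0; have r1 : ((r + 1)%R : nat) = (r.+1 %% (Zp_trunc p).+2)%N.
  by rewrite -[in RHS]addn1 -modnDmr /=.
have [rp|rp] := ltnP r.+1 (Zp_trunc p).+2.
  rewrite r1 modn_small // (bigD1 r) //=.
  rewrite [X in B r + X - _](eq_bigl (fun j : 'Z_p => (j < r)%N)) ?addrK // => j.
  by rewrite ltnS ltn_neqAle andbC.
(* Wrap-around: here [r + 1] is 0 and the first sum is empty, so the vanishing of the total is what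
   closes the telescope. *)
have rE : r.+1 = (Zp_trunc p).+2 by apply/eqP; rewrite eqn_leq rp ltn_ord.
rewrite r1 rE modnn big_pred0 // sub0r.
rewrite [in LHS](eq_bigl (fun j : 'Z_p => j != r)).
  by apply/eqP; rewrite eq_sym -addr_eq0 -[X in _ == X]B0 [in X in _ == X](bigD1 r).
move=> j; have := ltn_ord j; rewrite -[X in (j < X)%N]rE ltnS leq_eqVlt.
rewrite -val_eqE /=; case: ltngtP => //.
Qed.

Lemma gop_antidiff (b : cochain 'Z_p V) s : proper s -> s != [::] ->
  gop vact (@knorm p) b s = 0 -> gop vact (@kdiff p) (antidiff b) s = b s.
Proof.
move=> ps s0 bs; rewrite gop_diff; last exact: vact0.
pose r := mean s; pose B (j : 'Z_p) := b (map (vact (j - r)) s).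
rewrite /antidiff mean_act // -/r.
have -> : b s = B r by rewrite /B subrr (eq_map vact0) map_id.
rewrite -(Zp_partial_sums (B := B)); last first.
  rewrite -[RHS]bs /gop (reindex_inj (addIr r)) /=; apply: eq_bigr => j _.
  by rewrite /B addrK mul1r.
congr (_ - _); apply: eq_bigr => j _; rewrite /B -map_comp; congr b.
by apply: eq_map => v /=; rewrite vact_add; congr vact; ring.
Qed.

Lemma alternating_antidiff b : alternating b -> alternating (antidiff b).
Proof.
move=> ba; have ja g := alternating_map (vact g) ba.
split=> [u x y w|u x w]; rewrite /antidiff; last first.
  by rewrite big1 // => j _; apply: (ja _).2.
have -> : mean (u ++ x :: y :: w) = mean (u ++ y :: x :: w).
  by apply: mean_eq_mem => z; rewrite !mem_cat !inE; congr (_ || _); rewrite orbCA.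
by rewrite -sumrN; apply: eq_bigr => j _; apply: (ja _).1.
Qed.

(** Designed for [level_cob]: the coboundary of the previous level is divided by the norm if [k'] is
    odd and by g - 1 if [k'] is even. *)
Fixpoint level (k : nat) : cochain 'Z_p V :=
  if k is k'.+1 then
    if odd k' then fun s => (mean s == 0)%:R * cob (level k') s
    else antidiff (cob (level k'))
  else fun s => if s is [:: v] then (mean s == 0)%:R else 0.

Lemma alternating_level k : alternating (level k).
Proof.
elim: k => [|k IH] /=.
  by split=> [[|u [|u' l]] x y w|[|u [|u' l]] x w] //=; rewrite oppr0.
have ca := alternating_cob IH; case: (odd k); last exact: alternating_antidiff.
by apply: alternating_mul => // s t st; rewrite (mean_eq_mem st).
Qed.

Lemma level0_norm v : proper [:: v] -> gop vact (@knorm p) (level 0) [:: v] = 1.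
Proof.
move=> pv; rewrite -[RHS](@gop_norm_mean (fun=> 1) [:: v]) //.
by apply: eq_gop => // g; rewrite /= mulr1.
Qed.

(** Division at level [j] requires that [kparity j.+1] kill [cob (level j)]. Inductively [kparity]
    commutes with [cob] and turns this level into the coboundary of the one below, so [cob_cob]
    applies; at the bottom the two vertices of an edge both contribute 1. *)
Lemma level_cob k s : proper s -> size s = k.+2 ->
  cob (level k) s = gop vact (@kparity p k) (level k.+1) s.
Proof.
have step j : (forall t, proper t -> size t = j.+2 ->
      gop vact (@kparity p j.+1) (cob (level j)) t = 0) ->
    forall t, proper t -> size t = j.+2 ->
    cob (level j) t = gop vact (@kparity p j) (level j.+1) t.
  move=> J t pt tj; have t0 : t != [::] by rewrite -size_eq0 tj.
  move: J; rewrite /kparity /=; case: (boolP (odd j)) => oj /= J; last first.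
    by rewrite gop_antidiff // J.
  (* Invariance under the generator 1 gives invariance under every [g] by induction on its
     representative. *)
  rewrite gop_norm_mean // => g; rewrite -(natr_Zp g); elim: (g : nat) => [|m IH].
    by rewrite (eq_map vact0) map_id.
  have := J _ (proper_act m%:R pt); rewrite size_map gop_diff; last exact: vact0.
  move=> /(_ tj)/eqP; rewrite subr_eq0 => /eqP; rewrite -IH => <-.
  rewrite -map_comp; congr (cob _ _); apply: eq_map => v /=.
  by rewrite vact_add -natr1 addrC.
elim: k s => [|k IH]; apply: step => s ps sk.
  case: s ps sk => [|x [|y []]] // ps _.
  rewrite -cob_gop /= !level0_norm ?subr0 ?subrr //.
  - by apply: proper_sub ps => z; rewrite !inE => ->.
  - by apply: proper_sub ps => z; rewrite !inE => ->; rewrite orbT.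
have -> : @kparity p k.+2 = @kparity p k by rewrite /kparity /= negbK.
rewrite -cob_gop -(cob_cob (level k) s); apply: eq_cob => t ts tk.
rewrite -IH //; first exact: proper_sub ps.
by move: tk; rewrite sk => -[].
Qed.

(** * Cycles of top dimension *)

(** Indexes the facets: for a tuple of (p - 1) d distinct vertices it says that the vertex missing
    from column [i] is [t i]. *)
Definition avoid (t : {ffun 'I_d -> 'Z_p}) s : bool :=
  [forall i : 'I_d, (i, t i) \notin s].

Lemma avoid_eq_mem t s s' : s =i s' -> avoid t s = avoid t s'.
Proof. by move=> ss; apply: eq_forallb => i; rewrite ss. Qed.

Lemma proper_avoid s : proper s -> exists t, avoid t s.
Proof.
move=> /forallP ps; exists [ffun i => xchoose (existsP (ps i))].
by apply/forallP => i; rewrite ffunE; exact: (xchooseP (existsP (ps i))).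
Qed.

(** The complement of the graph of [t] has exactly (p - 1) d elements, so a tuple of that many
    distinct vertices inside it exhausts it. *)
Lemma avoid_facet t s : uniq s -> size s = ((p - 1) * d)%N -> avoid t s ->
  forall i g, ((i, g) \in s) = (g != t i).
Proof.
move=> us ss /forallP st i g.
pose A := [pred v : V | v.2 != t v.1].
have sA : {subset s <= A}.
  by move=> [j k] vs; rewrite inE /=; apply: contraTneq vs => ->; apply: st.
have cA : #|A| = size s.
  rewrite ss mulnBl mul1n; have := cardC A; rewrite card_prod !card_ord.
  pose graph := fintype.image (fun i : 'I_d => ((i, t i) : V)) predT.
  rewrite (@eq_card _ (predC A) (mem graph)); last first.
    move=> [j k]; rewrite !inE negbK /=.
    by apply/eqP/fintype.imageP => [->|[l _ [-> ->]]] //; exists j.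
  rewrite fintype.card_image => [|j k [] //]; rewrite card_ord.
  by move: #|A| => m; rewrite Zp_trunc_prime mulnC => <-; rewrite addnK.
have : s =i enum A.
  apply: (uniq_min_size us _ _).2; last by rewrite -cardE cA.
  by move=> v /sA; rewrite mem_enum.
by move=> /(_ (i, g)) ->; rewrite mem_enum inE.
Qed.

Implicit Types (t : {ffun 'I_d -> 'Z_p}).

(* The ridge below the two facets is missing two vertices in column i, and its
   coboundary exchanges the two facets. *)
Lemma flip_facet t i g (z : chain 'Z_p V) :
  cycle_chain z -> sat (fun s => proper s && (size s == (p - 1) * d)%N) z ->
  (forall b, alternating b -> ev (fun s => (avoid t s)%:R * b s) z = 0) ->
  forall b, alternating b ->
    ev (fun s => (avoid [ffun j => if j == i then g else t j] s)%:R * b s) z = 0.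
Proof.
move=> zc zS Ht b ba; pose t' := [ffun j => if j == i then g else t j].
have t'i : t' i = g by rewrite ffunE eqxx.
have t'j j : j != i -> t' j = t j by rewrite ffunE => /negPf ->.
have [gt|gt] := eqVneq g (t i).
  suff tt : t' = t by rewrite -/t' tt; apply: Ht.
  by apply/ffunP => j; rewrite ffunE; case: eqP => // ->.
pose v : V := (i, g); pose v' : V := (i, t i).
pose rho w := if w == v then v' else w.
pose ridge s : 'Z_p := (avoid t s && avoid t' s)%:R.
pose beta s := ridge s * b (v' :: s).
have sym t0 s s' : s =i s' -> (avoid t0 s)%:R = (avoid t0 s')%:R :> 'Z_p.
  by move=> /avoid_eq_mem ->.
have rsym s s' : s =i s' -> ridge s = ridge s'.
  by move=> ss; rewrite /ridge !(avoid_eq_mem _ ss).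
have betaa : alternating beta by apply: alternating_mul rsym _; apply: alternating_cons.
(* Deleting [v'] from the facet of [t'], or [v] from the facet of [t], leaves the ridge; in the
   second case [rho] puts [v'] in place of [v]. Paired with a cycle, this expresses [b] on one facet
   through [b] composed with [rho] on the other. *)
have key s : proper s && (size s == (p - 1) * d)%N ->
    cob beta s = (avoid t' s)%:R * b s + (avoid t s)%:R * b (map rho s).
  move=> /andP[ps /eqP ss].
  have [us|us] := boolP (uniq s); last first.
    rewrite (alternating_not_uniq ba us).
    rewrite (alternating_not_uniq (alternating_map rho ba) us).
    by rewrite (alternating_not_uniq (alternating_cob betaa) us) !mulr0 addr0.
  pose rhs s := (avoid t' s)%:R * b s + (avoid t s)%:R * b (map rho s).
  have rhsa : alternating rhs.
    have [a1 a2] := alternating_mul (sym t') ba.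
    have [b1 b2] := alternating_mul (sym t) (alternating_map rho ba).
    split=> [u x y w|u x w]; rewrite /rhs; first by rewrite a1 b1 opprD.
    by rewrite a2 b2 addr0.
  have coba := alternating_cob betaa.
  have avoidE t0 w r : avoid t0 (w :: r) = (w.2 != t0 w.1) && avoid t0 r.
    apply/forallP/andP => [H|[wt /forallP H] j].
      split; last by apply/forallP => j; have := H j; rewrite inE negb_or => /andP[].
      have := H w.1; rewrite inE negb_or => /andP[/eqP e _].
      by apply/eqP => e'; apply: e; rewrite -e'; case: (w).
    rewrite inE negb_or H andbT; apply: contraNneq wt => <- //=.
  have [v's|v's] := boolP (v' \in s).
    apply: (alternating_eq_front coba rhsa v's) => r sr.
    have /andP[v'r ur] : uniq (v' :: r) by rewrite -(perm_uniq sr).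
    rewrite /rhs !avoidE /= eqxx mul0r addr0 t'i eq_sym gt /=.
    rewrite cob0 ?subr0 => [|r']; last by rewrite /beta /ridge avoidE /= eqxx mul0r.
    rewrite /beta /ridge; congr (_%:R * _); rewrite andb_idl // => /forallP r1.
    by apply/forallP => j; have [->//|ji] := eqVneq j i; have := r1 j; rewrite t'j.
  have [vs|vs] := boolP (v \in s).
    apply: (alternating_eq_front coba rhsa vs) => r sr.
    have /andP[vr ur] : uniq (v :: r) by rewrite -(perm_uniq sr).
    rewrite /rhs !avoidE /= t'i eqxx mul0r add0r gt /=.
    rewrite cob0 ?subr0 => [|r']; last first.
      by rewrite /beta /ridge !avoidE /= t'i eqxx andbF mul0r.
    rewrite /rho eqxx.
    have -> : map rho r = r.
      apply: map_id_in => w wr; rewrite /rho; case: eqP => // wv.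
      by rewrite -wv wr in vr.
    rewrite /beta /ridge; congr (_%:R * _); rewrite andb_idr // => /forallP r1.
    apply/forallP => j; have [->|ji] := eqVneq j i; first by rewrite t'i.
    by rewrite t'j.
  (* Neither [v] nor [v'] occurs: impossible, since a facet omits only one vertex of column [i]. *)
  have [t0 st0] := proper_avoid ps; have mem := avoid_facet us ss st0.
  move: v's vs; rewrite !mem !negbK => /eqP e1 /eqP e2.
  by rewrite e1 -e2 eqxx in gt.
have := zc beta; rewrite (eq_ev zS key) ev_add Ht ?addr0 //.
exact: alternating_map.
Qed.

(** No tuple of [z] is the facet of [s0], and any facet is reached from that one by [flip_facet],
    changing one column at a time. *)
Lemma top_cycle_vanish (s0 : 'I_d -> 'Z_p) a (z : chain 'Z_p V) :
  alternating a -> cycle_chain z ->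
  sat (fun s => proper s && (size s == (p - 1) * d)%N) z ->
  sat (fun s => [exists i, exists g, (g != s0 i) && ((i, g) \notin s)]) z ->
  ev a z = 0.
Proof.
move=> aa zc zS zs0.
pose t0 k : {ffun 'I_d -> 'Z_p} -> {ffun 'I_d -> 'Z_p} :=
  fun t => [ffun j : 'I_d => if (j < k)%N then t j else s0 j].
have vanish k t : (k <= d)%N ->
    forall b, alternating b -> ev (fun s => (avoid (t0 k t) s)%:R * b s) z = 0.
  elim: k => [_ b ba|k IH kd].
    rewrite (eq_ev (g := fun=> 0) (sat_predI zS zs0)) => [|s]; first exact: eq_ev0.
    move=> /andP[/andP[ps /eqP ss] /existsP[i /existsP[g /andP[gs gi]]]].
    have [us|us] := boolP (uniq s); last by rewrite (alternating_not_uniq ba us) mulr0.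
    have [st|] := boolP (avoid _ s); last by rewrite mul0r.
    by move: gi; rewrite (avoid_facet us ss st) ffunE /= gs.
  pose kO := Ordinal kd.
  have -> : t0 k.+1 t = [ffun j => if j == kO then t kO else t0 k t j].
    apply/ffunP => j; rewrite !ffunE ltnS leq_eqVlt -val_eqE /=.
    by case: (eqVneq (j : nat) k) => //= jk; congr (t _); apply: val_inj.
  exact: flip_facet (IH (ltnW kd)).
have td t : t0 d t = t by apply/ffunP => j; rewrite ffunE ltn_ord.
(* A top-dimensional tuple without repetitions is avoided by exactly one [t], so [a] is the sum of
   its restrictions to single facets. *)
have -> : ev a z = ev (fun s => \sum_t 1 * ((avoid t s)%:R * a s)) z.
  apply: eq_ev zS _ => s /andP[ps /eqP ss].
  have [us|us] := boolP (uniq s); last first.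
    by rewrite (alternating_not_uniq aa us) big1 // => t _; rewrite mulr0 mulr0.
  have [t st] := proper_avoid ps; have mem := avoid_facet us ss st.
  rewrite (bigD1 t) //= st !mul1r big1 ?addr0 // => t1 t1t; rewrite mul1r.
  suff -> : avoid t1 s = false by rewrite mul0r.
  apply: contraNF t1t => /forallP st1; apply/eqP/ffunP => i.
  by have := st1 i; rewrite mem negbK => /eqP.
rewrite ev_sum big1 // => t _; rewrite ev_scale -(td t) vanish ?mulr0 //.
Qed.
End Labels.

(** * The action on the sphere and equivariant labels *)

Section Action.
Variables (R : realType) (p n : nat) (to : {action 'Z_p &-> sphere R n}).
Hypotheses (to_cont : continuous_action to) (to_free : free_action to).
Notation S := (sphere R n).

Definition act_on (g : 'Z_p) (x : S) : S := to x g.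

Lemma act_on_add g h x : act_on g (act_on h x) = act_on (g + h) x.
Proof.
rewrite /act_on addrC; case: (to) => f [_ fM] /=.
by rewrite -[RHS]/(f x (h * g)%g) fM ?inE.
Qed.

Lemma act_on0 x : act_on 0 x = x.
Proof.
have := act_on_add 0 0 x; rewrite addr0 /act_on.
by case: (to) => f [/(_ 0) + _] /=; apply.
Qed.

Lemma act_on_inj x : injective (act_on ^~ x).
Proof.
move=> g h /= gh; apply/eqP; rewrite -subr_eq0; apply: contraPT gh => gh0 E.
apply: (to_free gh0 (x := act_on h x)).
by rewrite -[LHS]/(act_on _ _) act_on_add subrK E.
Qed.

Lemma translateE g A x : translate to g A x <-> A (act_on (- g) x).
Proof.
split=> [[y Ay <-]|Ax].
  by rewrite -[to y g]/(act_on g y) act_on_add addNr act_on0.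
by exists (act_on (- g) x) => //; rewrite -[LHS]/(act_on _ _) act_on_add subrr act_on0.
Qed.

Lemma closed_translate g A : closed A -> closed (translate to g A).
Proof.
move=> Ac; have -> : translate to g A = act_on (- g) @^-1` A.
  by apply/seteqP; split=> x /translateE.
by apply: preimage_closed => // x _; apply: to_cont.
Qed.

(** The action need not be isometric; asking for closeness of all translates at once makes the
    relation invariant. *)
Definition equi_close (e : R) : rel S :=
  fun x y => [forall g : 'Z_p, ball_rel e (act_on g x) (act_on g y)].

Lemma equi_close_act e g x y :
  equi_close e x y -> equi_close e (act_on g x) (act_on g y).
Proof.
move=> /forallP xy; apply/forallP => h; rewrite !act_on_add; exact: xy.
Qed.

Lemma equi_close_ball e x y : equi_close e x y -> ball x e y.
Proof. by move=> /forallP/(_ 0); rewrite !act_on0 => /asboolP. Qed.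

Lemma equi_close_mono e e' : e <= e' -> subrel (equi_close e) (equi_close e').
Proof.
move=> ee x y /forallP xy; apply/forallP => g. apply/asboolP.
by move/asboolP: (xy g); apply: le_ball.
Qed.

Lemma equi_close_refl e x : 0 < e -> equi_close e x x.
Proof. by move=> e0; apply/forallP => g; apply/asboolP; apply: ballxx. Qed.

(** Uniform continuity of the finitely many translations turns a sufficiently fine ordinary filling
    into one that is fine for [equi_close]. *)
Lemma equi_fill (F : comNzRingType) m e : (m < n.+1)%N -> 0 < e ->
  exists2 d, 0 < d & forall z : chain F S, cycle_chain z ->
    sat (fine predT (equi_close d) m) z ->
    exists w : chain F S, sat (fine predT (equi_close e) m.+1) w /\ bounds z w.
Proof.
move=> mn e0.
have [d1 d10 d1P] := compact_unif_continuous (@sphere_compact R n) to_cont e0.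
have [d d0 dP] := sphere_fill F mn d10.
exists d => // z zc zS; have [|w [wS wb]] := dP z zc.
  apply: sat_sub zS => s; apply: fine_sub => // x y /equi_close_ball xy.
  exact/asboolP.
exists w; split=> //; apply: sat_sub wS => s; apply: fine_sub => // x y /asboolP xy.
by apply/forallP => g; apply/asboolP; apply: d1P.
Qed.

(** One representative of each orbit is labelled by means of the cover, and the label is transported
    along the orbit. Freeness makes the transporting group element unique, whence equivariance. *)
Lemma equivariant_labelling d (A : 'I_d -> set S) :
  [set: S] = \bigcup_(i in [set: 'I_d]) \bigcup_(g in [set: 'Z_p])
    translate to g (A i) ->
  exists l : S -> 'I_d * 'Z_p,
    (forall g x, l (act_on g x) = vact g (l x)) /\
    (forall x, translate to (l x).2 (A (l x).1) x).
Proof.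
move=> cover.
have /choice[c cP] : forall x, exists v : 'I_d * 'Z_p, translate to v.2 (A v.1) x.
  move=> x; have : [set: S] x by [].
  by rewrite cover => -[i _ [g _ xA]]; exists (i, g).
have [x0 _] := sphere_nonempty R n.
pose orb x := [set y : S | exists g, x = act_on g y].
(* The set [orb x] is the same for all points of an orbit, hence so is the chosen element; it
   contains [x], so the default [x0] is never returned. *)
pose rep x := xget x0 (orb x).
have /choice[h hP] : forall x, exists g, x = act_on g (rep x).
  move=> x; have : orb x x by exists 0; rewrite act_on0.
  exact: xgetI.
have rep_act g x : rep (act_on g x) = rep x.
  congr (xget x0 _); apply/seteqP; split=> y [k E].
    by exists (- g + k); rewrite -act_on_add -E act_on_add addNr act_on0.
  by exists (g + k); rewrite -act_on_add -E.
exists (fun x => vact (h x) (c (rep x))); split=> [g x|x].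
  rewrite vact_add rep_act; congr vact; apply: (@act_on_inj (rep x)).
  by rewrite -[in LHS](rep_act g x) -hP -act_on_add -hP.
have repE : act_on (- h x) x = rep x.
  by rewrite {2}(hP x) act_on_add addNr act_on0.
by apply/translateE; rewrite opprD -act_on_add repE; apply/translateE.
Qed.
End Action.

(** * Choice of the scale and the final contradiction *)

Lemma finite_common_radius (R : realType) (I : finType) (P : I -> R -> Prop) :
  (forall i d e, 0 < e -> e <= d -> P i d -> P i e) ->
  (forall i, exists2 d, 0 < d & P i d) -> exists2 d, 0 < d & forall i, P i d.
Proof.
move=> Pmono Pex.
have /choice[f fP] : forall i, exists d, 0 < d /\ P i d.
  by move=> i; have [d] := Pex i; exists d.
have d0 : 0 < \big[Num.min/1]_i f i.
  by apply/bigmin_gtP; split=> // i _; case: (fP i).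
exists (\big[Num.min/1]_i f i) => // i; have [_] := fP i.
by apply: Pmono => //; apply: bigmin_le.
Qed.

Theorem theorem6p2 (R : realType) (p d n : nat)
    (p_prime : prime p) (d_ge1 : (1 <= d)%N) (n_def : n = ((p - 1) * d - 1)%N)
    (to : {action 'Z_p &-> sphere R n})
    (to_cont : continuous_action to) (to_free : free_action to)
    (A : 'I_d -> set (sphere R n))
    (A_closed : forall i : 'I_d, closed (A i))
    (A_cover : [set: sphere R n] =
       \bigcup_(i in [set: 'I_d]) \bigcup_(g in [set: 'Z_p])
         translate to g (A i))
    (A_empty : forall i : 'I_d,
       \bigcap_(g in [set: 'Z_p]) translate to g (A i) = set0) :
  forall s : 'I_d -> 'Z_p,
    \bigcap_(i in [set: 'I_d]) \bigcap_(g in [set: 'Z_p] `\ s i)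
      translate to g (A i) != set0.
Proof.
move=> s; apply/negP => /eqP s_empty.
(* The number of points of an n-simplex is the number of vertices of a facet of the join. *)
have n1 : n.+1 = ((p - 1) * d)%N.
  by rewrite n_def subn1 prednK // muln_gt0 subn_gt0 prime_gt1.
have [l [l_act lA]] := equivariant_labelling to_free A_cover.
have cS := @sphere_compact R n.
have [e1 e10 e1P] : exists2 e, 0 < e & forall (i : 'I_d) (x : sphere R n),
    exists g, forall y, ball x e y -> ~ translate to g (A i) y.
  apply: finite_common_radius => [i r e e0 er rP x|i].
    have [g gP] := rP x; exists g => y xy; apply: gP; exact: le_ball xy.
  apply: compact_lebesgue_number => // [g|x]; first exact: closed_translate.
  apply/existsNP => xA; suff : set0 x by [].
  by rewrite -(A_empty i) => g _; apply: xA.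
have [e2 e20 e2P] : exists2 e, 0 < e & forall x : sphere R n,
    exists i g, g != s i /\ forall y, ball x e y -> ~ translate to g (A i) y.
  (* The value [setT] at the excluded pairs [g = s i] ensures that the index whose set misses a ball
     is never one of them. *)
  pose C (v : 'I_d * 'Z_p) := if v.2 == s v.1 then setT else translate to v.2 (A v.1).
  have [|x|e e0 eP] := @compact_lebesgue_number R _ _ C cS.
  - move=> v; rewrite /C; case: ifP => _; [exact: closedT|exact: closed_translate].
  - apply/existsNP => xC; suff : set0 x by [].
    rewrite -s_empty => i _ g [_ /= gs]; have := xC (i, g).
    by rewrite /C /=; case: eqP.
  - exists e => // x; have [[i g] vP] := eP x; exists i, g.
    have := vP x (ballxx _ e0); rewrite /C /=; case: eqP => [_ []//|gs _].
    by split; [apply/eqP|move=> y /vP; rewrite /C /=; case: eqP].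
pose e0 := Num.min e1 e2.
have e00 : 0 < e0 by rewrite lt_min e10.
(* A small tuple lies in the ball about its first point, so [(i, g)] is not among its labels once
   [translate to g (A i)] misses that ball: [e1] gives properness, [e2] the missed vertex of the
   facet of [s]. *)
have small_proper t m : fine predT (equi_close to e0) m.+1 t ->
    proper (map l t) && [exists i, exists g, (g != s i) && ((i, g) \notin map l t)].
  move=> /fineP[tm _ et]; case: t tm et => // x t _ et.
  have xt y : y \in x :: t -> ball x e0 y.
    by move=> yt; apply/equi_close_ball/et => //; rewrite inE eqxx.
  have notin i g r : e0 <= r -> (forall y, ball x r y -> ~ translate to g (A i) y) ->
      (i, g) \notin map l (x :: t).
    move=> er rP; apply/negP => /mapP[y /xt xy yl].
    by have := rP y (le_ball er xy); apply; have := lA y; rewrite -yl.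
  apply/andP; split.
    apply/forallP => i; have [g gP] := e1P i x; apply/existsP; exists g.
    by apply: notin gP; rewrite ge_min lexx.
  have [i [g [gs gP]]] := e2P x; apply/existsP; exists i; apply/existsP; exists g.
  by rewrite gs (notin _ _ _ _ gP) // ge_min lexx orbT.
pose f k (t : seq (sphere R n)) := level k (map l t).
have [x0 _] := sphere_nonempty R n.
have act_add := act_on_add to; have act0 := act_on0 to.
have [||x [xS xc x1]] := @tower p (sphere R n) (act_on to) act_add act0
  R (equi_close to) n e0 (@equi_close_act _ _ _ to)
  (@equi_close_mono _ _ _ to) (@equi_close_refl _ _ _ to)
  (equi_fill to_cont 'Z_p) f x0 n e0 _ _ (leqnn n) e00 (lexx e0).
- move=> y; rewrite (gop_equivariant _ _ _ l_act); apply: (level0_norm p_prime).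
  have : fine predT (equi_close to e0) 1 [:: y].
    apply/fineP; split=> // u v; rewrite !mem_seq1 => /eqP-> /eqP->.
    exact: equi_close_refl.
  by move=> /small_proper/andP[].
- move=> k t tS; have /andP[pt _] := small_proper _ _ tS.
  have /fineP[tk _ _] := tS.
  rewrite (gop_equivariant _ _ _ l_act) cob_map.
  by apply: level_cob => //; rewrite size_map.
pose y := gact (act_on to) (@knorm p) x.
have yc : cycle_chain y := gact_norm_cycle act_add xc.
have yS : sat (fine predT (equi_close to e0) n.+1) y.
  by apply: (sat_gact _ xS) => g t; apply: small_act => *; apply: equi_close_act.
(* By adjunction of [gact] and [gop], [x1] gives this same pairing the value 1. *)
have : ev (level n) (push l y) = 0.
  refine (@top_cycle_vanish p d p_prime s (level n) (push l y)
    (@alternating_level p d n) (push_cycle l yc) _ _).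
    apply: sat_push yS _ => t tS; have /andP[-> _] := small_proper _ _ tS.
    by case/fineP: tS => tn _ _; rewrite size_map tn n1 eqxx.
  by apply: sat_push yS _ => t /small_proper/andP[].
by rewrite ev_push ev_gact x1 => /eqP; rewrite oner_eq0.
Qed.
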